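(* Let $P$ be a hyperbounded bi-stochastic Markov operator on a probability space $(S,\Sigma,\mu)$. Then for every $1<r<\infty$, $P$ is quasi-compact in $L^r(\mu)$.
   Context: Let $(S,\Sigma,\mu)$ be a probability space and $P(x,A)$ a transition probability on $S\times\Sigma$, with Markov operator $Pf(x)=\int f(y)P(x,dy)$. $P$ is called bi-stochastic on $(S,\Sigma,\mu)$ if $\mu$ is invariant, i.e. $\int P(x,A)\,d\mu(x)=\mu(A)$ for all $A\in\Sigma$; then $P$ induces a contraction of every $L^p(\mu)$, $1\le p\le\infty$. A bi-stochastic Markov operator $P$ is called hyperbounded if for some $1<p<q\le\infty$ it maps $L^p(\mu)$ into $L^q(\mu)$. A bounded operator $T$ on a Banach space is quasi-compact if there are $n\ge1$ and a compact operator $K$ with $\|T^n-K\|<1$. The spaces $L^r(\mu)$ are complex. *)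

(* Defs.v *)
From HB Require Import structures.
From mathcomp Require Import all_boot all_order all_algebra.
From mathcomp Require Import complex.
From mathcomp Require Import all_classical all_reals all_analysis.
From mathcomp Require Import measurable_realfun ess_sup_inf.

Set Implicit Arguments.
Unset Strict Implicit.
Unset Printing Implicit Defensive.

Import Order.TTheory GRing.Theory Num.Theory.
Import numFieldNormedType.Exports.
Import ComplexField.Normc.

Local Open Scope classical_set_scope.
Local Open Scope ring_scope.

Local Notation Re := (@complex.Re _).
Local Notation Im := (@complex.Im _).
Local Notation normc := (@ComplexField.Normc.normc _).

(* The library orders R[i] and gives it a norm with values in R[i]; normc is
   the modulus with values in R. *)
Section complex_modulus.
Context {R : realType}.
Implicit Types z w : R[i].

Lemma cnormE z : `|z| = real_complex R (normc z).
Proof. by case: z. Qed.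

Lemma normc_ge0 z : 0 <= normc z.
Proof. by case: z => a b /=; exact: sqrtr_ge0. Qed.

Lemma ler_normcD z w : normc (z + w) <= normc z + normc w.
Proof. by rewrite -lecR rmorphD/= -!cnormE ler_normD. Qed.

Lemma normcN z : normc (- z) = normc z.
Proof. by case: z => a b /=; rewrite !sqrrN. Qed.

Lemma cReD z w : Re (z + w) = Re z + Re w.
Proof. by case: z; case: w. Qed.

Lemma cImD z w : Im (z + w) = Im z + Im w.
Proof. by case: z; case: w. Qed.

Lemma cReM z w : Re (z * w) = Re z * Re w - Im z * Im w.
Proof. by case: z; case: w. Qed.

Lemma cImM z w : Im (z * w) = Re z * Im w + Im z * Re w.
Proof. by case: z; case: w. Qed.

Lemma Re_normc z : `|Re z| <= normc z.
Proof.
by case: z => a b /=; rewrite -sqrtr_sqr ler_wsqrtr// lerDl sqr_ge0.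
Qed.

Lemma Im_normc z : `|Im z| <= normc z.
Proof.
by case: z => a b /=; rewrite -sqrtr_sqr ler_wsqrtr// lerDr sqr_ge0.
Qed.

Lemma normc_le_ReIm z : normc z <= `|Re z| + `|Im z|.
Proof.
case: z => a b; rewrite -[Complex a b]addr0.
have -> : Complex a b + 0 = Complex a 0 + Complex 0 b.
  by rewrite addr0; congr Complex; rewrite ?addr0 ?add0r.
apply: le_trans (ler_normcD _ _) _.
by rewrite /= expr0n/= addr0 add0r !sqrtr_sqr addr0 add0r.
Qed.

(* Cauchy--Schwarz in the plane *)
Lemma ReIm_normcM z w : Re z * Re w + Im z * Im w <= normc z * normc w.
Proof.
have := Re_normc (conjc z * w); rewrite normcM.
have -> : normc (conjc z) = normc z by case: z => a b /=; rewrite sqrrN.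
move=> /(le_trans (ler_norm _)); congr (_ <= _).
by case: z => a b; case: w => c e /=; rewrite mulNr opprK.
Qed.

Lemma normc_sqr z : normc z ^+ 2 = Re z ^+ 2 + Im z ^+ 2.
Proof. by case: z => a b /=; rewrite sqr_sqrtr// addr_ge0 ?sqr_ge0. Qed.

End complex_modulus.

Section complex_valued_functions.
Context {d : measure_display} {T : measurableType d} {R : realType}.
Implicit Types (mu : {measure set T -> \bar R}) (p : \bar R) (f g : T -> R[i]).

Definition cmeasurable f :=
  measurable_fun setT (Re \o f) /\ measurable_fun setT (Im \o f).

(* the integral of a non-integrable real or imaginary part is 0 by convention *)
Definition cintegral mu f : R[i] :=
  Complex (\int[mu]_x Re (f x)) (\int[mu]_x Im (f x)).

(* for p = +oo, Lnorm is the essential supremum *)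
Definition cLnorm mu p f : \bar R := 'N[mu]_p[EFin \o (normc \o f)]%E.

Definition cLfun mu p : {pred T -> R[i]} :=
  mem [set f | cmeasurable f /\ (cLnorm mu p f < +oo)%E].

Lemma cLfunP mu p f :
  reflect (cmeasurable f /\ (cLnorm mu p f < +oo)%E) (f \in cLfun mu p).
Proof. by apply: (iffP idP); rewrite inE. Qed.

Lemma cmeasurable_cst (c : R[i]) : cmeasurable (cst c).
Proof. by split; exact: measurable_cst. Qed.

Lemma cmeasurableD f g : cmeasurable f -> cmeasurable g -> cmeasurable (f + g).
Proof.
move=> [rf mf] [rg mg]; split.
- rewrite (_ : _ \o _ = (Re \o f) \+ (Re \o g)); first exact: measurable_funD.
  by apply/funext => x /=; rewrite cReD.
- rewrite (_ : _ \o _ = (Im \o f) \+ (Im \o g)); first exact: measurable_funD.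
  by apply/funext => x /=; rewrite cImD.
Qed.

Lemma cmeasurableZ (c : R[i]) f : cmeasurable f -> cmeasurable (c *: f).
Proof.
move=> [rf mf]; split.
- rewrite (_ : _ \o _ = (cst (Re c) \* (Re \o f)) \- (cst (Im c) \* (Im \o f))).
    by apply: measurable_funB; apply: measurable_funM => //; exact: measurable_cst.
  by apply/funext => x /=; rewrite -cReM.
- rewrite (_ : _ \o _ = (cst (Re c) \* (Im \o f)) \+ (cst (Im c) \* (Re \o f))).
    by apply: measurable_funD; apply: measurable_funM => //; exact: measurable_cst.
  by apply/funext => x /=; rewrite -cImM.
Qed.

Lemma measurable_normc f : cmeasurable f -> measurable_fun setT (normc \o f).
Proof.
move=> [rf mf].
rewrite (_ : _ \o _ = (@Num.sqrt R) \o
    (fun x => Re (f x) ^+ 2 + Im (f x) ^+ 2)); last first.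
  by apply/funext => x /=; case: (f x).
apply: measurableT_comp; last first.
  by apply: measurable_funD; apply: measurable_funX.
apply: continuous_measurable_fun; exact: sqrt_continuous.
Qed.

Lemma cLnorm_ge0 mu p f : (0 <= cLnorm mu p f)%E.
Proof. exact: Lnorm_ge0. Qed.

Lemma le_Lnorm mu p (f g : T -> \bar R) : (1 <= p)%E ->
  measurable_fun setT f -> measurable_fun setT g ->
  {ae mu, forall x, `|f x| <= `|g x|}%E ->
  ('N[mu]_p[f] <= 'N[mu]_p[g])%E.
Proof.
move=> p1 mf mg fg; rewrite unlock.
case: p p1 => [p|_|//].
- rewrite lee_fin => p1.
  have p0 : 0 < p by rewrite (lt_le_trans ltr01).
  apply: gt0_ler_poweR.
  + by rewrite invr_ge0 ltW.
  + by rewrite in_itv/= leey integral_ge0// => x _; exact: poweR_ge0.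
  + by rewrite in_itv/= leey integral_ge0// => x _; exact: poweR_ge0.
  have mpow (h : T -> \bar R) : measurable_fun setT h ->
      measurable_fun setT (fun x => `|h x| `^ p)%E.
    move=> mh; apply: (measurableT_comp (measurable_poweR _)).
    exact: measurableT_comp.
  apply: ae_ge0_le_integral; rewrite ?measurableT//; do ?exact: mpow.
  + by move=> x _; exact: poweR_ge0.
  + by move=> x _; exact: poweR_ge0.
  + apply: filterS fg => x fgx _.
    by apply: gt0_ler_poweR => //; rewrite ?(ltW p0)// in_itv/= abse_ge0 leey.
- by case: ifPn => // _; apply: le_ess_sup.
Qed.

Lemma cLnormD mu p f g : (1 <= p)%E -> cmeasurable f -> cmeasurable g ->
  (cLnorm mu p (f + g)%R <= cLnorm mu p f + cLnorm mu p g)%E.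
Proof.
move=> p1 mf mg.
have mf' := measurable_normc mf; have mg' := measurable_normc mg.
apply: le_trans (eminkowski _ mf' mg' p1).
apply: le_Lnorm => //.
- exact/measurable_EFinP/measurable_normc/cmeasurableD.
- exact/measurable_EFinP/measurable_funD.
apply/aeW => x /=; rewrite lee_fin ger0_norm ?normc_ge0//.
by rewrite ger0_norm ?addr_ge0 ?normc_ge0// ler_normcD.
Qed.

Lemma cLnormZ mu p (c : R[i]) f : (1 <= p)%E -> f \in cLfun mu p ->
  (cLnorm mu p (c *: f)%R = (normc c)%:E * cLnorm mu p f)%E.
Proof.
move=> p1 /cLfunP[mf lf].
have nf : normc \o f \in Lfun mu p.
  by apply/andP; split; rewrite inE//; exact: measurable_normc.
have := LnormZ (Lfun_Sub p1 nf) (normc c); rewrite Lfun_valP.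
rewrite ger0_norm ?normc_ge0// => <-; rewrite /cLnorm; congr Lnorm.
by apply/funext => x /=; rewrite normcM.
Qed.

Lemma cLnorm_ae_eq mu p f g : (1 <= p)%E ->
  cmeasurable f -> cmeasurable g -> f = g %[ae mu] ->
  cLnorm mu p f = cLnorm mu p g.
Proof.
move=> p1 mf mg fg; apply/eqP; rewrite eq_le; apply/andP; split.
- apply: le_Lnorm => //; [exact/measurable_EFinP/measurable_normc..|].
  by apply: filterS fg => x /(_ I) /= ->.
- apply: le_Lnorm => //; [exact/measurable_EFinP/measurable_normc..|].
  by apply: filterS fg => x /(_ I) /= ->.
Qed.

Lemma cLnorm_eq0 mu p f : (1 <= p)%E -> cmeasurable f ->
  cLnorm mu p f = 0 -> f = 0 %[ae mu].
Proof.
move=> p1 mf /Lnorm_eq0_eq0.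
have /measurable_EFinP mnf := measurable_normc mf.
move=> /(_ mnf (lt_le_trans lte01 p1)).
by apply: filterS => x /(_ I) [] /eq0_normc.
Qed.

End complex_valued_functions.

Record cLfunType (d : measure_display) (T : measurableType d) (R : realType)
    (mu : {measure set T -> \bar R}) (p : \bar R) (p1 : (1 <= p)%E) := CLfun {
  cLfun_fun :> T -> R[i];
  cLfun_prop : cLfun_fun \in cLfun mu p }.

Section cLfun_lmodule.
Context {d : measure_display} {T : measurableType d} {R : realType}.
Variables (mu : {measure set T -> \bar R}) (p : \bar R) (p1 : (1 <= p)%E).
Local Notation cLfunType := (cLfunType mu p1).

HB.instance Definition _ := [isSub for @cLfun_fun d T R mu p p1].
HB.instance Definition _ := [Choice of cLfunType by <:].

Lemma cLfun_submod_closed : submod_closed (cLfun (T := T) mu p).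
Proof.
split.
  apply/cLfunP; split; first exact: cmeasurable_cst.
  rewrite /cLnorm (_ : _ \o _ = cst 0%E).
    by rewrite Lnorm0 ?ltry// gt_eqF// (lt_le_trans _ p1)// lte01.
  by apply/funext => x /=; rewrite expr0n/= addr0 sqrtr0.
move=> c f g fL gL; have [mf lf] := cLfunP _ _ _ fL.
have [mg lg] := cLfunP _ _ _ gL.
apply/cLfunP; split; first by apply: cmeasurableD => //; exact: cmeasurableZ.
apply: (le_lt_trans (cLnormD _ p1 (cmeasurableZ c mf) mg)).
rewrite lte_add_pinfty// cLnormZ// lte_mul_pinfty// lee_fin.
exact: normc_ge0.
Qed.

HB.instance Definition _ := GRing.isSubmodClosed.Build _ _ (cLfun (T := T) mu p)
  cLfun_submod_closed.
HB.instance Definition _ := [SubChoice_isSubLmodule of cLfunType by <:].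

Lemma cLfun_measurable (f : cLfunType) : cmeasurable f.
Proof. by have /cLfunP[] := cLfun_prop f. Qed.

Lemma cLnorm_fin_num (f : cLfunType) : cLnorm mu p f \is a fin_num.
Proof.
by rewrite ge0_fin_numE ?cLnorm_ge0//; have /cLfunP[] := cLfun_prop f.
Qed.

Definition cae_eq (f g : cLfunType) : bool := `[< (f : T -> R[i]) = g %[ae mu] >].

Lemma cae_eq_is_equiv : equiv_class_of cae_eq.
Proof.
split=> [f|f g|g f h].
- by apply/asboolP; exact: aeW.
- by apply/asboolP/asboolP; apply: filterS => x fg xT; rewrite fg.
- move=> /asboolP fg /asboolP gh; apply/asboolP.
  by apply: filterS2 fg gh => x fg gh xT; rewrite fg ?gh.
Qed.

Canonical cae_eq_equiv := EquivRelPack cae_eq_is_equiv.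

End cLfun_lmodule.

(* The normed space L^p(mu) of complex functions modulo a.e. equality.  Its norm
   takes values in the scalar field R[i], as normedModType requires. *)
Section cLspace.
Context {d : measure_display} {T : measurableType d} {R : realType}.
Variables (mu : {measure set T -> \bar R}) (p : \bar R) (p1 : (1 <= p)%E).

Local Open Scope quotient_scope.

Definition cLspace : Type := {eq_quot @cae_eq d T R mu p p1}.
HB.instance Definition _ := Choice.on cLspace.
HB.instance Definition _ := EqQuotient.on cLspace.

Definition cLclass (f : cLfunType mu p1) : cLspace := \pi_cLspace f.

Lemma cLclassP (f g : cLfunType mu p1) :
  cLclass f = cLclass g <-> (f : T -> R[i]) = g %[ae mu].
Proof.
split=> [/eqP|fg].
  by rewrite /cLclass eqmodE => /asboolP.
by apply/eqP; rewrite /cLclass eqmodE; exact/asboolP.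
Qed.

Lemma cLclass_repr (u : cLspace) : cLclass (repr u) = u.
Proof. exact: reprK. Qed.

Lemma repr_cLclass (f : cLfunType mu p1) :
  (repr (cLclass f) : T -> R[i]) = f %[ae mu].
Proof. by apply/cLclassP; rewrite cLclass_repr. Qed.

Definition cLzero : cLspace := cLclass 0.
Definition cLadd (u v : cLspace) : cLspace := cLclass (repr u + repr v).
Definition cLopp (u : cLspace) : cLspace := cLclass (- repr u).
Definition cLscale (c : R[i]) (u : cLspace) : cLspace := cLclass (c *: repr u).
Definition cLspace_norm (u : cLspace) : R[i] :=
  real_complex R (fine (cLnorm mu p (repr u))).

Lemma cLclass_add (f g : cLfunType mu p1) :
  cLadd (cLclass f) (cLclass g) = cLclass (f + g).
Proof.
apply/cLclassP; apply: filterS2 (repr_cLclass f) (repr_cLclass g) => x fx gx xT.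
by rewrite /= /GRing.add/= fx// gx.
Qed.

Lemma cLclass_opp (f : cLfunType mu p1) : cLopp (cLclass f) = cLclass (- f).
Proof.
apply/cLclassP; apply: filterS (repr_cLclass f) => x fx xT.
by rewrite /= /GRing.opp/= fx.
Qed.

Lemma cLclass_scale c (f : cLfunType mu p1) :
  cLscale c (cLclass f) = cLclass (c *: f).
Proof.
apply/cLclassP; apply: filterS (repr_cLclass f) => x fx xT.
by rewrite /= /GRing.scale/= fx.
Qed.

Lemma cLspace_ind (Q : cLspace -> Prop) :
  (forall f, Q (cLclass f)) -> forall u, Q u.
Proof. by move=> Qf u; rewrite -(cLclass_repr u). Qed.

Let cLaddA : associative cLadd.
Proof.
elim/cLspace_ind => f; elim/cLspace_ind => g; elim/cLspace_ind => h.
by rewrite !cLclass_add addrA.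
Qed.

Let cLaddC : commutative cLadd.
Proof.
elim/cLspace_ind => f; elim/cLspace_ind => g.
by rewrite !cLclass_add addrC.
Qed.

Let cLadd0 : left_id cLzero cLadd.
Proof. by elim/cLspace_ind => f; rewrite cLclass_add add0r. Qed.

Let cLaddN : left_inverse cLzero cLopp cLadd.
Proof. by elim/cLspace_ind => f; rewrite cLclass_opp cLclass_add addNr. Qed.

HB.instance Definition _ := GRing.isZmodule.Build cLspace
  cLaddA cLaddC cLadd0 cLaddN.

Let cLscaleA a b u : cLscale a (cLscale b u) = cLscale (a * b) u.
Proof. by elim/cLspace_ind: u => f; rewrite !cLclass_scale scalerA. Qed.

Let cLscale1 : left_id 1 cLscale.
Proof. by elim/cLspace_ind => f; rewrite cLclass_scale scale1r. Qed.

Let cLscaleDr : right_distributive cLscale +%R.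
Proof.
move=> a; elim/cLspace_ind => f; elim/cLspace_ind => g.
by rewrite /GRing.add/= !(cLclass_add, cLclass_scale) scalerDr.
Qed.

Let cLscaleDl u : {morph cLscale^~ u : a b / a + b}.
Proof.
elim/cLspace_ind: u => f a b.
by rewrite !cLclass_scale [RHS]cLclass_add scalerDl.
Qed.

HB.instance Definition _ := GRing.Zmodule_isLmodule.Build R[i] cLspace
  cLscaleA cLscale1 cLscaleDr cLscaleDl.

Lemma cLclassD : {morph cLclass : f g / f + g}.
Proof. by move=> f g; rewrite -cLclass_add. Qed.

Lemma cLclassZ c : {morph cLclass : f / c *: f}.
Proof. by move=> f; rewrite -cLclass_scale. Qed.

Lemma cLspace_normE (f : cLfunType mu p1) :
  cLspace_norm (cLclass f) = real_complex R (fine (cLnorm mu p f)).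
Proof.
congr (real_complex R (fine _)); apply: cLnorm_ae_eq => //.
- exact: cLfun_measurable.
- exact: cLfun_measurable.
- exact: repr_cLclass.
Qed.

Let ler_cLnormD u v :
  cLspace_norm (u + v) <= cLspace_norm u + cLspace_norm v.
Proof.
elim/cLspace_ind: u => f; elim/cLspace_ind: v => g.
rewrite -cLclassD !cLspace_normE -rmorphD lecR -fineD ?cLnorm_fin_num//.
rewrite fine_le ?fin_numD ?cLnorm_fin_num//.
by apply: cLnormD => //; exact: cLfun_measurable.
Qed.

Let cLspace_normZ c u : cLspace_norm (c *: u) = `|c| * cLspace_norm u.
Proof.
elim/cLspace_ind: u => f; rewrite -cLclassZ !cLspace_normE cnormE -rmorphM.
by rewrite cLnormZ ?cLfun_prop// fineM// cLnorm_fin_num.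
Qed.

Let cLspace_norm0 u : cLspace_norm u = 0 -> u = 0.
Proof.
elim/cLspace_ind: u => f; rewrite cLspace_normE => /complexI /eqP f0.
apply/cLclassP; apply: (cLnorm_eq0 p1 (cLfun_measurable f)).
by rewrite -(fineK (cLnorm_fin_num f)) (eqP f0).
Qed.

HB.instance Definition _ := Lmodule_isNormed.Build R[i] cLspace
  ler_cLnormD cLspace_normZ cLspace_norm0.

End cLspace.

Section operators.
Context {R : realType}.

(* `|A u| is a nonnegative element of R[i], hence the real part; the norm of an
   unbounded map is +oo *)
Definition opnorm (V W : normedModType R[i]) (A : V -> W) : \bar R :=
  ereal_sup [set (Re `|A u|)%:E | u in [set u | `|u| <= 1]].

Definition compact_operator (V W : normedModType R[i]) (K : {linear V -> W}) :=
  compact (closure [set K u | u in [set u | `|u| <= 1]]).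

Definition quasi_compact (V : normedModType R[i]) (A : {linear V -> V}) :=
  continuous A /\
  exists n : nat, exists K : {linear V -> V},
    [/\ (1 <= n)%N, compact_operator K &
        (opnorm (iter n A \- K)%R < 1)%E].

End operators.

Section complex_integral.
Context {d : measure_display} {T : measurableType d} {R : realType}.
Variable mu : {measure set T -> \bar R}.
Implicit Types f g : T -> R[i].

Lemma cintegrableP f : cmeasurable f ->
  (\int[mu]_x (normc (f x))%:E < +oo)%E ->
  mu.-integrable setT (EFin \o (Re \o f)) /\
  mu.-integrable setT (EFin \o (Im \o f)).
Proof.
move=> mf lf; have [rf imf] := mf.
have intf : mu.-integrable setT (EFin \o (normc \o f)).
  apply/integrableP; split; first exact/measurable_EFinP/measurable_normc.
  by under eq_integral do rewrite gee0_abs ?lee_fin ?normc_ge0//.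
split; apply: le_integrable intf => //.
- exact/measurable_EFinP.
- by move=> x _ /=; rewrite lee_fin (ger0_norm (normc_ge0 _)) Re_normc.
- exact/measurable_EFinP.
- by move=> x _ /=; rewrite lee_fin (ger0_norm (normc_ge0 _)) Im_normc.
Qed.

Lemma normc_cintegral f : cmeasurable f ->
  ((normc (cintegral mu f))%:E <= \int[mu]_x (normc (f x))%:E)%E.
Proof.
move=> mf; have [->|] := eqVneq (\int[mu]_x (normc (f x))%:E)%E +oo%E.
  by rewrite leey.
rewrite -ltey => lf; have [irf iimf] := cintegrableP mf lf.
have intf : mu.-integrable setT (EFin \o (normc \o f)).
  apply/integrableP; split; first exact/measurable_EFinP/measurable_normc.
  by under eq_integral do rewrite gee0_abs ?lee_fin ?normc_ge0//.
set z := cintegral mu f.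
have fin : (\int[mu]_x (normc (f x))%:E)%E \is a fin_num.
  exact: (integrable_fin_num measurableT intf).
rewrite -(fineK fin) lee_fin -/(Rintegral mu setT (normc \o f)).
have [z0|z0] := eqVneq (normc z) 0.
  by rewrite z0; apply: Rintegral_ge0 => x _; exact: normc_ge0.
have zp : 0 < normc z by rewrite lt_def z0 normc_ge0.
rewrite -(ler_pM2l zp) -expr2 normc_sqr.
have -> : Re z ^+ 2 + Im z ^+ 2 =
    \int[mu]_x (Re z * Re (f x) + Im z * Im (f x)).
  rewrite RintegralD//.
  - by rewrite !RintegralZl// !expr2.
  - exact: (integrableZl measurableT (Re z) irf).
  - exact: (integrableZl measurableT (Im z) iimf).
rewrite -RintegralZl//; apply: le_Rintegral => //.
- exact: (integrableD measurableT (integrableZl measurableT (Re z) irf)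
    (integrableZl measurableT (Im z) iimf)).
- exact: (integrableZl measurableT (normc z) intf).
- by move=> x _; exact: ReIm_normcM.
Qed.

Lemma cintegral_ae_eq f g : cmeasurable f -> cmeasurable g ->
  f = g %[ae mu] -> cintegral mu f = cintegral mu g.
Proof.
move=> [rf imf] [rg img] fg; congr Complex; congr fine.
- apply: ae_eq_integral => //; [exact/measurable_EFinP..|].
  by apply: filterS fg => x /[apply] /= ->.
- apply: ae_eq_integral => //; [exact/measurable_EFinP..|].
  by apply: filterS fg => x /[apply] /= ->.
Qed.

Lemma cintegralD f g : cmeasurable f -> cmeasurable g ->
  (\int[mu]_x (normc (f x))%:E < +oo)%E ->
  (\int[mu]_x (normc (g x))%:E < +oo)%E ->
  cintegral mu (f + g) = cintegral mu f + cintegral mu g.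
Proof.
move=> mf mg lf lg.
have [rf imf] := cintegrableP mf lf; have [rg img] := cintegrableP mg lg.
congr Complex.
- by rewrite -RintegralD//; apply: eq_Rintegral => x _; rewrite -cReD.
- by rewrite -RintegralD//; apply: eq_Rintegral => x _; rewrite -cImD.
Qed.

Lemma cintegralZ (c : R[i]) f : cmeasurable f ->
  (\int[mu]_x (normc (f x))%:E < +oo)%E ->
  cintegral mu (c *: f) = c * cintegral mu f.
Proof.
move=> mf lf; have [rf imf] := cintegrableP mf lf.
rewrite [RHS](_ : _ = Complex (Re c * Re (cintegral mu f) - Im c * Im (cintegral mu f))
  (Re c * Im (cintegral mu f) + Im c * Re (cintegral mu f))); last first.
  by case: c; case: (cintegral mu f).
rewrite -!RintegralZl//.
have iZ (a : R) h : mu.-integrable setT (EFin \o h) ->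
    mu.-integrable setT (EFin \o (fun x => a * h x)).
  exact: (integrableZl measurableT a).
congr Complex.
- rewrite -RintegralB//; [|exact: iZ..].
  by apply: eq_Rintegral => x _; rewrite -cReM.
- rewrite -RintegralD//; [|exact: iZ..].
  by apply: eq_Rintegral => x _; rewrite -cImM.
Qed.

End complex_integral.

Section markov.
Context {d : measure_display} {S : measurableType d} {R : realType}.
Variables (mu : probability S R) (P : R.-pker S ~> S).

Definition bistochastic :=
  forall A : set S, measurable A -> (\int[mu]_x P x A = mu A)%E.

Definition markov (f : S -> R[i]) (x : S) : R[i] := cintegral (P x) f.

(* The exponent q may be +oo.  Since p > 1, the integral defining markov f x
   converges for mu-almost every x when f is in L^p and mu is invariant, see
   cLfun_ae_integrable. *)
Definition hyperbounded := exists p q : \bar R,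
  [/\ (1 < p)%E, (p < q)%E &
      forall f, f \in cLfun mu p -> markov f \in cLfun mu q].

Lemma cmeasurable_markov f : cmeasurable f -> cmeasurable (markov f).
Proof.
have mint (h : S -> R) : measurable_fun setT h ->
    measurable_fun setT (fun x => \int[P x]_y h y).
  move=> /measurable_EFinP mh.
  have -> : (fun x => \int[P x]_y h y) = fine \o ((fun x =>
      \int[P x]_y (EFin \o h)^\+%E y) \- (fun x => \int[P x]_y (EFin \o h)^\-%E y))%E.
    by apply/funext => x /=; rewrite /Rintegral integralE.
  apply: measurableT_comp => //.
  apply: emeasurable_funB; apply: measurable_fun_integral_kernel.
  - exact: measurable_kernel.
  - by move=> x; exact: funepos_ge0.
  - exact: measurable_funepos.
  - exact: measurable_kernel.
  - by move=> x; exact: funeneg_ge0.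
  - exact: measurable_funeneg.
by move=> [rf imf]; split; exact: mint.
Qed.

(* mu and P seen as kernels from S and from S * S, so that integral_kcomp
   applies in bistochastic_integral *)
Definition kcst (_ : S) : {measure set S -> \bar R} := mu.

Let measurable_kcst U : measurable U -> measurable_fun setT (kcst ^~ U).
Proof. by move=> mU; exact: measurable_cst. Qed.

HB.instance Definition _ := isKernel.Build _ _ S S R kcst measurable_kcst.

Let kcst1 x : kcst x setT = 1%E.
Proof. exact: probability_setT. Qed.

HB.instance Definition _ := Kernel_isProbability.Build _ _ S S R kcst kcst1.

Definition ksnd (xy : S * S) : {measure set S -> \bar R} := P xy.2.

Let measurable_ksnd U : measurable U -> measurable_fun setT (ksnd ^~ U).
Proof.
by move=> mU; exact: (measurableT_comp (measurable_kernel P U mU)).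
Qed.

HB.instance Definition _ := isKernel.Build _ _ (S * S)%type S R ksnd measurable_ksnd.

Let ksnd1 x : ksnd x setT = 1%E.
Proof. exact: prob_kernel. Qed.

HB.instance Definition _ :=
  Kernel_isProbability.Build _ _ (S * S)%type S R ksnd ksnd1.

Hypothesis muP : bistochastic.

Lemma bistochastic_integral (h : S -> \bar R) : (forall x, 0 <= h x)%E ->
  measurable_fun setT h -> (\int[mu]_x \int[P x]_y h y = \int[mu]_x h x)%E.
Proof.
move=> h0 mh; rewrite -(@integral_kcomp _ _ _ S S S R kcst ksnd point h h0 mh).
by apply: eq_measure_integral => A mA _; exact: muP.
Qed.

Lemma bistochastic_ae (Q : set S) : {ae mu, forall y, Q y} ->
  {ae mu, forall x, {ae P x, forall y, Q y}}.
Proof.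
move=> [N [mN N0 QN]].
have /ae_eq_integral_abs : (\int[mu]_x `|P x N| = 0)%E.
  by under eq_integral do rewrite gee0_abs//; rewrite muP.
move=> /(_ measurableT (measurable_kernel P N mN)).
apply: filterS => x /(_ I) PN0; exists N; split => //.
Qed.

Lemma markov_ae_eq f g : cmeasurable f -> cmeasurable g ->
  f = g %[ae mu] -> markov f = markov g %[ae mu].
Proof.
move=> mf mg /bistochastic_ae; apply: filterS => x fg _.
exact: cintegral_ae_eq.
Qed.

Lemma cLfun_ae_integrable p f : (1 <= p)%E -> f \in cLfun mu p ->
  {ae mu, forall x, \int[P x]_y (normc (f y))%:E < +oo}%E.
Proof.
move=> p1 /cLfunP[mf lf]; have mnf := measurable_normc mf.
have : normc \o f \in Lfun mu p.
  by apply/andP; split; rewrite inE.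
have muT : mu setT \is a fin_num by rewrite probability_setT.
move=> /(Lfun_subset (lexx _) p1 muT p1)/Lfun1_integrable/integrableP[_].
under eq_integral do rewrite gee0_abs ?lee_fin ?normc_ge0//.
rewrite -bistochastic_integral; last 2 first.
- by move=> x; rewrite lee_fin normc_ge0.
- exact/measurable_EFinP.
have mI : measurable_fun setT (fun x => \int[P x]_y (normc (f y))%:E)%E.
  apply: measurable_fun_integral_kernel.
  - exact: measurable_kernel.
  - by move=> y; rewrite lee_fin normc_ge0.
  - exact/measurable_EFinP.
have I0 x : (0 <= \int[P x]_y (normc (f y))%:E)%E.
  by apply: integral_ge0 => y _; rewrite lee_fin normc_ge0.
move=> lI.
have /(integrable_ae measurableT) :
    mu.-integrable setT (fun x => \int[P x]_y (normc (f y))%:E)%E.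
  by apply/integrableP; split => //; under eq_integral do rewrite gee0_abs//.
by apply: filterS => x /(_ I); rewrite ge0_fin_numE.
Qed.

Lemma markovD p f g : (1 <= p)%E -> f \in cLfun mu p -> g \in cLfun mu p ->
  markov (f + g) = markov f + markov g %[ae mu].
Proof.
move=> p1 fL gL; have [mf _] := cLfunP _ _ _ fL; have [mg _] := cLfunP _ _ _ gL.
apply: filterS2 (cLfun_ae_integrable p1 fL) (cLfun_ae_integrable p1 gL).
by move=> x lf lg _; exact: cintegralD.
Qed.

Lemma markovZ p (c : R[i]) f : (1 <= p)%E -> f \in cLfun mu p ->
  markov (c *: f) = c *: markov f %[ae mu].
Proof.
move=> p1 fL; have [mf _] := cLfunP _ _ _ fL.
by apply: filterS (cLfun_ae_integrable p1 fL) => x lf _; exact: cintegralZ.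
Qed.

(* Jensen's inequality for the probability measure P x *)
Lemma jensen_kernel (r : R) f x : 1 <= r -> cmeasurable f ->
  (`|(normc (markov f x))%:E| `^ r <= \int[P x]_y (`|(normc (f y))%:E| `^ r))%E.
Proof.
move=> r1 mf; have r0 : 0 < r by rewrite (lt_le_trans ltr01).
have mnf := measurable_normc mf.
rewrite -(@powR_Lnorm _ _ _ (P x) (EFin \o (normc \o f))) ?gt_eqF//.
have N1r : ('N[P x]_1[EFin \o (normc \o f)] <= 'N[P x]_r%:E[EFin \o (normc \o f)])%E.
  move: r1; rewrite le_eqVlt => /predU1P[<-//|r1].
  have r'0 : 0 < (1 - r^-1)^-1 :> R.
    by rewrite invr_gt0 subr_gt0 invf_lt1.
  have := @hoelder _ _ _ (P x) (normc \o f) (cst 1) r (1 - r^-1)^-1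
    mnf (measurable_cst _) r0 r'0.
  rewrite invrK subrKC => /(_ erefl).
  rewrite [X in 'N[_]_1[X]%E](_ : _ = EFin \o (normc \o f)); last first.
    by apply/funext => y /=; rewrite mulr1.
  by rewrite Lnorm_cst1 prob_kernel poweR_EFin powR1 mule1.
apply: gt0_ler_poweR; rewrite ?(ltW r0)//.
- by rewrite in_itv/= leey andbT lee_fin normr_ge0.
- by rewrite in_itv/= leey Lnorm_ge0.
apply: le_trans N1r; rewrite Lnorm1 gee0_abs ?lee_fin ?normc_ge0//.
under eq_integral do rewrite gee0_abs ?lee_fin ?normc_ge0//.
exact: normc_cintegral.
Qed.

Lemma markov_contraction p f : (1 <= p)%E -> cmeasurable f ->
  (cLnorm mu p (markov f) <= cLnorm mu p f)%E.
Proof.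
move=> p1 mf; have mnf := measurable_normc mf.
have mPf := measurable_normc (cmeasurable_markov mf).
rewrite /cLnorm unlock; case: p p1 => [r|_|//].
- rewrite lee_fin => r1; have r0 : 0 < r by rewrite (lt_le_trans ltr01).
  have mpow (h : S -> R) : measurable_fun setT h ->
      measurable_fun setT (fun x => `|(h x)%:E| `^ r)%E.
    move=> mh; apply: (measurableT_comp (measurable_poweR _)).
    by apply: measurableT_comp => //; exact/measurable_EFinP.
  apply: gt0_ler_poweR.
  + by rewrite invr_ge0 ltW.
  + by rewrite in_itv/= leey integral_ge0// => x _; exact: poweR_ge0.
  + by rewrite in_itv/= leey integral_ge0// => x _; exact: poweR_ge0.
  rewrite -[leRHS]bistochastic_integral; last 2 first.
  + by move=> x; exact: poweR_ge0.
  + exact: mpow.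
  apply: ge0_le_integral => //.
  + by move=> x _; exact: poweR_ge0.
  + exact: mpow.
  + apply: measurable_fun_integral_kernel.
    * exact: measurable_kernel.
    * by move=> y; exact: poweR_ge0.
    * exact: mpow.
  + by move=> x _; exact: jensen_kernel.
- case: ifPn => // mu0; apply/ess_supP.
  have := bistochastic_ae (ess_sup_ge mu (abse \o (EFin \o (normc \o f)))).
  apply: filterS => x fM; rewrite [leLHS]/= ger0_norm ?normc_ge0//.
  set M := ess_sup _ _ in fM *.
  apply: le_trans (normc_cintegral _ mf) _.
  have M0 : (0 <= M)%E.
    by apply: (ess_sup_gee mu0); apply: aeW => y; exact: abse_ge0.
  have -> : M = (\int[P x]_y cst M y)%E.
    by rewrite integral_cst// prob_kernel mule1.
  apply: ae_ge0_le_integral => //.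
  + by move=> y _; rewrite lee_fin normc_ge0.
  + exact/measurable_EFinP.
  + apply: filterS fM => y /= yM _.
    by apply: le_trans yM; rewrite lee_fin ler_norm.
Qed.

Lemma markov_cLfun p f : (1 <= p)%E -> f \in cLfun mu p ->
  markov f \in cLfun mu p.
Proof.
move=> p1 /cLfunP[mf lf]; apply/cLfunP; split; first exact: cmeasurable_markov.
exact: le_lt_trans (markov_contraction p1 mf) lf.
Qed.

End markov.

Section markov_operator.
Context {d : measure_display} {S : measurableType d} {R : realType}.
Context {mu : probability S R} {P : R.-pker S ~> S}.
Variable (muP : bistochastic mu P).
Context {p : \bar R}.
Variable (p1 : (1 <= p)%E).

Definition markov_fun (f : cLfunType mu p1) : cLfunType mu p1 :=
  CLfun p1 (markov_cLfun muP p1 (cLfun_prop f)).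

(* the choice of representative is irrelevant by markov_opE *)
Definition markov_op (u : cLspace mu p1) : cLspace mu p1 :=
  cLclass (markov_fun (repr u)).

Lemma markov_opE (f : cLfunType mu p1) :
  markov_op (cLclass f) = cLclass (markov_fun f).
Proof.
apply/cLclassP; apply: (markov_ae_eq muP).
- exact: cLfun_measurable.
- exact: cLfun_measurable.
- exact: repr_cLclass.
Qed.

Let markov_op_linear : linear markov_op.
Proof.
move=> c u v; rewrite -(cLclass_repr u) -(cLclass_repr v).
move: (repr u) (repr v) => f g.
rewrite -cLclassZ -cLclassD !markov_opE -cLclassZ -cLclassD.
apply/cLclassP.
have := markovD muP p1 (cLfun_prop (c *: f)) (cLfun_prop g).
apply: filterS2 (markovZ muP c p1 (cLfun_prop f)) => x fx gx xT.
apply: etrans (gx xT) _; congr (_ + _); exact: (fx xT).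
Qed.

HB.instance Definition _ := GRing.isLinear.Build R[i] (cLspace mu p1)
  (cLspace mu p1) _ markov_op markov_op_linear.

Lemma markov_op_norm u : `|markov_op u| <= `|u|.
Proof.
rewrite -(cLclass_repr u); move: (repr u) => {u} f.
rewrite markov_opE [leLHS]cLspace_normE [leRHS]cLspace_normE lecR.
rewrite fine_le ?cLnorm_fin_num//; apply: markov_contraction => //.
exact: cLfun_measurable.
Qed.

Lemma markov_op_continuous : continuous markov_op.
Proof.
apply: bounded_linear_continuous; apply/linear_boundedP.
near=> r => u; apply: le_trans (markov_op_norm u) _.
rewrite ler_peMl//; near: r; apply: nbhs_pinfty_ge.
Unshelve. all: by end_near. Qed.

End markov_operator.

Arguments markov_op {d S R mu P} muP {p} p1 u.

(* Main.v *)
From HB Require Import structures.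
From mathcomp Require Import all_boot all_order all_algebra.
From mathcomp Require Import complex.
From mathcomp Require Import all_classical all_reals all_analysis.
From mathcomp Require Import measurable_realfun ring lra zify.
Require Import Defs.

Set Implicit Arguments.
Unset Strict Implicit.
Unset Printing Implicit Defensive.

Import Order.TTheory GRing.Theory Num.Theory.
Import numFieldNormedType.Exports.
Import ComplexField.Normc.

Local Open Scope classical_set_scope.
Local Open Scope ring_scope.

Local Notation Re := (@complex.Re _).
Local Notation Im := (@complex.Im _).
Local Notation normc := (@ComplexField.Normc.normc _).

(* Let [e A] be the probability that two independent [P]-steps from a common
   [mu]-distributed point separate [A] from its complement.  Hyperboundedness
   gives [mu A <= 4 * e A] as soon as [mu A] is small: otherwise a suitable
   superposition of almost invariant small sets is in L^p while its image is
   not in L^q.  Hence a partition into almost invariant cells has boundedly many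
   cells, and a maximal one at a well-chosen scale satisfies
   [\sum_i min (mu (A_i `&` B)) (mu (A_i `\` B)) <= k + L * e B] for all [B],
   with [k] as small as we please.

   If [f] is normalized in L^r and [P f] has norm close to 1, then the Jensen gap
   [\int P (|f|^r) - |P f|^r], which is the integral of a Bregman divergence, is
   small; so the level sets of the functions [max 0 (Re (u * f)) ^ r], with [u] a
   fourth root of unity, have small total energy [e], and [f] is close in L^r to
   a function of the partition, hence to its conditional expectation [E f].  So
   for every normalized [f] either the norm of [P f] is at most [1 - dl] or
   [f - E f] is small, and in both cases [P f - (dl / 4) * P (E f)] has norm
   bounded away from 1, while [P \o E] has finite rank.  Thus the power [n = 1]
   suffices. *)

(** * Pointwise inequalities *)

Section real_inequalities.
Context {R : realType}.
Implicit Types a b r s : R.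

(** Young's inequality with exponents [s] and [s / (s - 1)], for [a] and the power [s - 1] of [b]: a
    convex power lies above its tangent at [b]. *)
Lemma young_tangent s a b : 1 <= s -> 0 <= a -> 0 <= b ->
  s * (a * b `^ (s - 1)) <= a `^ s + (s - 1) * b `^ s.
Proof.
move=> s1 a0 b0; move: s1; rewrite le_eqVlt => /predU1P[<-|s1].
  by rewrite subrr mul0r powRr0 powRr1// mulr1 mul1r addr0.
have s0 : 0 < s by rewrite (lt_trans ltr01).
have s10 : 0 < s - 1 by rewrite subr_gt0.
have := conjugate_powR a0 (powR_ge0 b (s - 1)) s0 (divr_gt0 s0 s10).
rewrite -powRrM mulrCA divff ?gt_eqF// mulr1 invf_div => /(_ _)/wrap[].
  by field; rewrite gt_eqF.
rewrite -(ler_pM2l s0) => /le_trans; apply.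
by rewrite le_eqVlt; apply/orP; left; apply/eqP; field; rewrite !gt_eqF.
Qed.

Lemma powR_half_sqr r a : 0 < r -> (a `^ (r / 2)) ^+ 2 = a `^ r.
Proof.
by move=> r0; rewrite -powR_mulrn ?powR_ge0// -powRrM divfK// pnatr_eq0.
Qed.

(* The right side is the gap between [t `^ r] and its tangent at [b], evaluated
   at [a]. *)
Lemma powR_tangent_gap r a b : 1 < r -> 0 <= a -> 0 <= b ->
  Num.min 1 (r - 1) * (a `^ (r / 2) - b `^ (r / 2)) ^+ 2 <=
    a `^ r + (r - 1) * b `^ r - r * (a * b `^ (r - 1)).
Proof.
move=> r1 a0 b0; have r0 : 0 < r by rewrite (lt_trans ltr01).
rewrite -(powR_half_sqr a r0) -(powR_half_sqr b r0).
set A := a `^ (r / 2); set B := b `^ (r / 2).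
have B0 : 0 <= B := powR_ge0 _ _.
(* For [2 <= r], the tangent inequality with exponent [r / 2], multiplied by [B], leaves the full
   square [(A - B) ^+ 2]. *)
have [r2|r2] := leP 2 r.
  have r21 : 1 <= r / 2 by rewrite ler_pdivlMr// mul1r.
  have := young_tangent r21 a0 b0; rewrite -/A -/B => /(ler_wpM2l B0).
  have -> : b `^ (r - 1) = b `^ (r / 2 - 1) * B.
    rewrite -powRD; last by apply/implyP => /eqP; lra.
    by congr (_ `^ _); field.
  set E := b `^ _; rewrite minEle ifT; [nra|lra].
(* For [r < 2], Young's inequality for the powers [2 - r] of [a] and [r - 1] of [a * b] yields
   multiples of [A ^+ 2] and [A * B]. *)
have := @conjugate_powR R (a `^ (2 - r)) ((a * b) `^ (r - 1))
  (r / (2 - r)) (r / (2 * (r - 1))) (powR_ge0 _ _) (powR_ge0 _ _).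
have r20 : 0 < 2 - r by lra.
have r10 : 0 < r - 1 by lra.
rewrite !divr_gt0 ?mulr_gt0// => /(_ isT isT); rewrite !invf_div => /(_ _)/wrap[].
  by field; rewrite gt_eqF.
rewrite -!powRrM.
have -> : (2 - r) * (r / (2 - r)) = r by field; rewrite gt_eqF.
have -> : (r - 1) * (r / (2 * (r - 1))) = r / 2 by field; rewrite gt_eqF.
rewrite !powRM// -/A -/B mulrA -powRD; last by apply/implyP => /eqP; lra.
rewrite (_ : 2 - r + (r - 1) = 1); last by ring.
rewrite powRr1// -(powR_half_sqr a r0) -/A => /(ler_wpM2l (ltW r0)).
set E := a * _.
have -> : r * (A ^+ 2 * ((2 - r) / r) + A * B * (2 * (r - 1) / r)) =
    (2 - r) * A ^+ 2 + 2 * (r - 1) * (A * B).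
  by field; rewrite !gt_eqF.
rewrite minEle ifF; last by apply/negbTE; rewrite -ltNge; lra.
nra.
Qed.

Lemma max0_dist a b : `|Num.max 0 a - Num.max 0 b| <= `|a - b|.
Proof.
rewrite !maxEle; case: (leP 0 a) => ha; case: (leP 0 b) => hb;
  rewrite ?subrr ?sub0r ?subr0 ?normrN ?normr0 ?normr_ge0//.
  by rewrite !ger0_norm; lra.
by rewrite distrC !ger0_norm; lra.
Qed.

Lemma powR_superadditive r a b : 1 <= r -> 0 <= a -> 0 <= b ->
  a `^ r + b `^ r <= (a + b) `^ r.
Proof.
move=> r1 a0 b0; have r0 : 0 < r by rewrite (lt_le_trans ltr01).
rewrite -[X in X + _]mulr_powRB1// -[X in _ + X <= _]mulr_powRB1//.
rewrite -[leRHS]mulr_powRB1 ?addr_ge0// mulrDl.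
by apply: lerD; apply: ler_wpM2l => //; apply: ge0_ler_powR;
  rewrite ?subr_ge0// ?nnegrE ?addr_ge0// ?lerDl ?lerDr.
Qed.

(** Superadditivity for [a - b] and [b]. Closeness of r-th powers in L^1 thus becomes closeness in
    L^r. *)
Lemma powR_dist r a b : 1 <= r -> 0 <= a -> 0 <= b ->
  `|a - b| `^ r <= `|a `^ r - b `^ r|.
Proof.
move=> r1; wlog ab : a b / b <= a => [W a0 b0|a0 b0].
  have [ab|/ltW ba] := leP b a; first exact: W.
  by rewrite distrC [leRHS]distrC; exact: W.
have := @powR_superadditive r (a - b) b r1; rewrite subr_ge0 subrK => /(_ ab b0) H.
rewrite !ger0_norm ?subr_ge0//; first by rewrite lerBrDr.
by apply: ge0_ler_powR => //; rewrite (le_trans ler01).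
Qed.

(** The tangent is taken at the larger point, where its slope is at most [r]. *)
Lemma powR_lipschitz01 r a b : 1 <= r -> 0 <= a <= 1 -> 0 <= b <= 1 ->
  `|a `^ r - b `^ r| <= r * `|a - b|.
Proof.
move=> r1; wlog ab : a b / b <= a => [W a0 b0|/andP[a0 a1] /andP[b0 b1]].
  have [/W|/ltW/W] := leP b a; first exact.
  by rewrite distrC [X in _ <= _ * X]distrC; apply.
have r0 : 0 < r by rewrite (lt_le_trans ltr01).
rewrite !ger0_norm ?subr_ge0//; last first.
  by apply: ge0_ler_powR; rewrite ?nnegrE// ltW.
have := young_tangent r1 b0 a0.
have E1 : a `^ (r - 1) <= 1.
  by apply: le_trans (ge0_ler_powR _ _ _ a1) _; rewrite ?nnegrE ?subr_ge0 ?powR1.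
have := @mulr_powRB1 _ a r a0 r0.
have := powR_ge0 a (r - 1).
set E := a `^ (r - 1) in E1 *; move=> E0 <- H.
have : 0 <= r * ((a - b) * (1 - E)) by rewrite !mulr_ge0 ?subr_ge0// ltW.
nra.
Qed.

End real_inequalities.

(** * Bregman divergence of powers of the modulus *)

Section bregman.
Context {R : realType}.
Variable r : R.
Hypothesis r1 : 1 < r.
Implicit Types w m : R[i].

Definition repos (w : R[i]) : R := (Num.max 0 (Re w)) `^ r.

(* The Bregman divergence of [w |-> `|w| ^ r]: by definition of the slope (which
   is [0] at [m = 0], where the division yields [0]) it integrates to the Jensen
   gap when [m] is the mean of [w]. *)
Definition bregman_slope (m : R[i]) : R := r * normc m `^ (r - 1) / normc m.

Definition bregman (w m : R[i]) : R := normc w `^ r - normc m `^ r -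
  bregman_slope m * ((Re w - Re m) * Re m + (Im w - Im m) * Im m).

Let r0 : 0 < r. Proof. exact: lt_trans ltr01 r1. Qed.

Lemma repos_ge0 w : 0 <= repos w.
Proof. exact: powR_ge0. Qed.

Lemma repos_le w : repos w <= normc w `^ r.
Proof.
apply: ge0_ler_powR; rewrite ?nnegrE ?(ltW r0)// ?normc_ge0 ?le_max ?lexx//.
by rewrite ge_max normc_ge0 (le_trans (ler_norm _) (Re_normc _)).
Qed.

Lemma normc_gt0 w : (0 < normc w) = (w != 0).
Proof.
rewrite lt_def normc_ge0 andbT; congr negb.
by apply/eqP/eqP => [/eq0_normc//|->]; rewrite normc0.
Qed.

(* Splits the divergence into a radial part and an angular part, the latter
   being half the squared distance of the unit vectors. *)
Lemma bregman_polar w m : 0 < normc w -> 0 < normc m ->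
  bregman w m = (normc w `^ r + (r - 1) * normc m `^ r -
      r * (normc w * normc m `^ (r - 1))) +
    r / 2 * (normc w * normc m `^ (r - 1)) *
      ((Re w / normc w - Re m / normc m) ^+ 2 +
       (Im w / normc w - Im m / normc m) ^+ 2).
Proof.
move=> a0 b0; rewrite /bregman /bregman_slope.
have := normc_sqr w; have := normc_sqr m.
have := @mulr_powRB1 _ (normc m) r (ltW b0) r0.
set a := normc w in a0 *; set b := normc m in b0 *.
set E := b `^ (r - 1) => <- hb ha.
have -> : (Re w / a - Re m / b) ^+ 2 + (Im w / a - Im m / b) ^+ 2 =
  2 - 2 * (Re w * Re m + Im w * Im m) / (a * b).
  transitivity ((Re w ^+ 2 + Im w ^+ 2) / a ^+ 2 + (Re m ^+ 2 + Im m ^+ 2) / b ^+ 2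
     - 2 * (Re w * Re m + Im w * Im m) / (a * b)).
    by field; rewrite !gt_eqF.
  by rewrite -ha -hb !divff ?gt_eqF ?exprn_gt0.
have -> : (Re w - Re m) * Re m + (Im w - Im m) * Im m =
    Re w * Re m + Im w * Im m - b ^+ 2 by rewrite hb; ring.
by field; rewrite !gt_eqF.
Qed.

(** Both terms on the left are nonnegative, so the divergence controls the change of modulus and the
    change of direction separately. *)
Lemma bregman_radial w m : 0 < normc w -> 0 < normc m ->
  Num.min 1 (r - 1) * (normc w `^ (r / 2) - normc m `^ (r / 2)) ^+ 2 +
    r / 2 * (normc w * normc m `^ (r - 1)) *
      ((Re w / normc w - Re m / normc m) ^+ 2 +
       (Im w / normc w - Im m / normc m) ^+ 2) <= bregman w m.
Proof.
move=> a0 b0; rewrite bregman_polar// lerD2r.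
by apply: powR_tangent_gap; rewrite ?normc_ge0.
Qed.

Lemma bregman0l m : bregman 0 m = (r - 1) * normc m `^ r.
Proof.
rewrite /bregman normc0 powR0 ?gt_eqF// sub0r.
have -> : (Re 0 - Re m) * Re m + (Im 0 - Im m) * Im m = - normc m ^+ 2.
  by rewrite normc_sqr /=; ring.
have [m0|m0] := eqVneq (normc m) 0.
  by rewrite m0 powR0 ?gt_eqF// expr0n/= !oppr0 !mulr0 subr0.
rewrite /bregman_slope -(@mulr_powRB1 _ (normc m) r) ?normc_ge0//.
by field.
Qed.

Lemma bregman0r w : bregman w 0 = normc w `^ r.
Proof.
by rewrite /bregman /bregman_slope normc0 invr0 mulr0 mul0r powR0 ?gt_eqF// !subr0.
Qed.

Let c0 : 0 < Num.min 1 (r - 1).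
Proof. by rewrite lt_min ltr01 subr_gt0. Qed.

Lemma bregman_ge0 w m : 0 <= bregman w m.
Proof.
have [->|w0] := eqVneq w 0.
  by rewrite bregman0l mulr_ge0 ?powR_ge0// subr_ge0 ltW.
have [->|m0] := eqVneq m 0; first by rewrite bregman0r powR_ge0.
apply: le_trans (bregman_radial _ _); rewrite ?normc_gt0//.
apply: addr_ge0; first by apply: mulr_ge0; [exact: ltW|exact: sqr_ge0].
apply: mulr_ge0; last by rewrite addr_ge0 ?sqr_ge0.
by rewrite !mulr_ge0 ?normc_ge0 ?powR_ge0 ?invr_ge0// ltW.
Qed.

(** [repos] is the r-th power of the modulus times a Lipschitz function of the direction. Changes of
    either kind are bounded by a geometric mean of the divergence and the r-th powers, and the
    latter can be given the small weight [e]. *)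
Lemma repos_bregman (e : R) : 0 < e -> exists2 C : R, 0 <= C &
  forall w m, `|repos w - repos m| <=
    e * (normc w `^ r + normc m `^ r) + C * bregman w m.
Proof.
move=> e0; have := c0; set c := Num.min 1 (r - 1) => c1.
have r10 : 0 < r - 1 by rewrite subr_gt0.
(* The four terms serve in turn the case [m = 0], the case [w = 0], the modulus estimate [T1] and
   the direction estimate [T2]. *)
exists (1 + (r - 1)^-1 + (c * e)^-1 + 2 * r / e).
  by rewrite !addr_ge0 ?divr_ge0 ?mulr_ge0 ?invr_ge0 ?mulr_ge0 ?ltW// ltW.
move=> w m; have D0 := bregman_ge0 w m.
have p0 : 0 <= e * (normc w `^ r + normc m `^ r).
  by rewrite mulr_ge0 ?addr_ge0 ?powR_ge0// ltW.
have q1 : 0 <= (r - 1)^-1 by rewrite invr_ge0 ltW.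
have q2 : 0 <= (c * e)^-1 by rewrite invr_ge0 mulr_ge0 ?ltW.
have q3 : 0 <= 2 * r / e by rewrite divr_ge0 ?mulr_ge0 ?ltW.
have repos0 : repos 0 = 0 by rewrite /repos maxxx powR0// gt_eqF.
have [w0|w0] := eqVneq w 0.
  rewrite w0 in D0 p0 *; rewrite repos0 sub0r normrN ger0_norm ?repos_ge0//.
  apply: le_trans (repos_le m) _.
  apply: (ler_wpDl p0).
  have -> : normc m `^ r = (r - 1)^-1 * bregman 0 m.
    by rewrite bregman0l mulKf// gt_eqF.
  by rewrite ler_wpM2r//; lra.
have [m0|m0] := eqVneq m 0.
  rewrite m0 in D0 p0 *; rewrite repos0 subr0 ger0_norm ?repos_ge0//.
  apply: le_trans (repos_le w) _.
  apply: (ler_wpDl p0).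
  by rewrite -{1}(bregman0r w) -{1}(mul1r (bregman w 0)) ler_wpM2r//; lra.
move: w0 m0; rewrite -!normc_gt0 => w0 m0.
have := bregman_radial w0 m0; rewrite -/c.
have HB := powR_half_sqr (normc m) r0; have HA := powR_half_sqr (normc w) r0.
have Epos : 0 <= normc w * normc m `^ (r - 1).
  by rewrite mulr_ge0 ?powR_ge0 ?normc_ge0.
have El : r * (normc w * normc m `^ (r - 1)) <= r * (normc w `^ r + normc m `^ r).
  apply: le_trans (young_tangent (ltW r1) (ltW w0) (ltW m0)) _.
  have := powR_ge0 (normc w) r; have := powR_ge0 (normc m) r; nra.
pose x1 := Num.max 0 (Re w); pose y1 := Num.max 0 (Re m).
have le01 (u : R[i]) : 0 < normc u -> 0 <= Num.max 0 (Re u) / normc u <= 1.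
  move=> u0; rewrite divr_ge0 ?normc_ge0 ?le_max ?lexx//=.
  rewrite ler_pdivrMr// mul1r ge_max normc_ge0/=.
  exact: le_trans (ler_norm _) (Re_normc _).
have Ew : repos w = (x1 / normc w) `^ r * normc w `^ r.
  by rewrite -powRM ?divfK ?gt_eqF// ?divr_ge0// ?le_max ?lexx// ltW.
have Em : repos m = (y1 / normc m) `^ r * normc m `^ r.
  by rewrite -powRM ?divfK ?gt_eqF// ?divr_ge0// ?le_max ?lexx// ltW.
have lip := powR_lipschitz01 (ltW r1) (le01 w w0) (le01 m m0).
rewrite -/x1 -/y1 in lip.
set al := x1 / normc w in Ew lip; set be := y1 / normc m in Em lip.
have al01 : 0 <= al `^ r <= 1.
  have /andP[al0 al1] := le01 w w0; rewrite powR_ge0/=.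
  by apply: le_trans (ge0_ler_powR _ _ _ al1) _; rewrite ?nnegrE ?powR1// ltW.
have be01 : 0 <= be `^ r <= 1.
  have /andP[be0 be1] := le01 m m0; rewrite powR_ge0/=.
  by apply: le_trans (ge0_ler_powR _ _ _ be1) _; rewrite ?nnegrE ?powR1// ltW.
set G := _ ^+ 2 + _ ^+ 2 => HD.
(* The positive part is 1-Lipschitz and commutes with division by the modulus, so one coordinate of
   the direction suffices. *)
have dG : (al - be) ^+ 2 <= G.
  apply: le_trans (_ : (Re w / normc w - Re m / normc m) ^+ 2 <= _); last first.
    by rewrite lerDl sqr_ge0.
  rewrite /al /be /x1 /y1.
  have maxD (p q : R) : 0 < q -> Num.max 0 p / q = Num.max 0 (p / q).
    move=> q0; rewrite !maxEle.
    by rewrite (pmulr_lge0 p) ?invr_gt0//; case: ifP => // _; rewrite mul0r.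
  rewrite !maxD// -[leLHS]real_normK ?num_real// -[leRHS]real_normK ?num_real//.
  by rewrite ler_sqr ?nnegrE ?normr_ge0 ?max0_dist.
(* The smaller r-th power is below the weight of the direction term in [bregman_radial]; hence
   [split] attaches the smaller power to the change of direction. *)
have minE : Num.min (normc w `^ r) (normc m `^ r) <= normc w * normc m `^ (r - 1).
  rewrite ge_min; have [wm|mw] := leP (normc w) (normc m).
    apply/orP; left; rewrite -(@mulr_powRB1 _ (normc w) r) ?normc_ge0//.
    by rewrite ler_wpM2l ?ge0_ler_powR ?nnegrE ?normc_ge0// ltW.
  apply/orP; right; rewrite -(@mulr_powRB1 _ (normc m) r) ?normc_ge0//.
  by rewrite ler_wpM2r ?powR_ge0// ltW.
have split : `|repos w - repos m| <= `|normc w `^ r - normc m `^ r| +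
    Num.min (normc w `^ r) (normc m `^ r) * `|al `^ r - be `^ r|.
  rewrite Ew Em; set x := al `^ r in al01 *; set y := be `^ r in be01 *.
  set p := normc w `^ r; set q := normc m `^ r.
  have p0' : 0 <= p := powR_ge0 _ _; have q0' : 0 <= q := powR_ge0 _ _.
  move: al01 be01 => /andP[x0 x1'] /andP[y0 y1'].
  have [pq|qp] := leP p q.
    have -> : x * p - y * q = (p - q) * y + p * (x - y) by ring.
    apply: le_trans (ler_normD _ _) _; rewrite !normrM.
    rewrite (ger0_norm p0') lerD2r (ger0_norm y0).
    by rewrite ler_piMr.
  have -> : x * p - y * q = (p - q) * x + q * (x - y) by ring.
  apply: le_trans (ler_normD _ _) _; rewrite !normrM.
  by rewrite (ger0_norm q0') lerD2r (ger0_norm x0) ler_piMr.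
apply: le_trans split _.
rewrite -HA -HB in p0 El minE HD *.
set A := normc w `^ (r / 2) in p0 El minE HD *.
set B := normc m `^ (r / 2) in p0 El minE HD *.
set E := normc w * _ in Epos El minE HD *.
move: lip dG; set d := `|al - be| => lip.
rewrite -(real_normK (num_real (al - be))) -/d => dG.
have d0 : 0 <= d := normr_ge0 _.
set M := Num.min _ _ in minE *.
have M0 : 0 <= M by rewrite le_min !sqr_ge0.
have HR : c * (A - B) ^+ 2 <= bregman w m.
  apply: le_trans HD; rewrite lerDl; apply: mulr_ge0.
    by rewrite mulr_ge0// divr_ge0// ltW.
  by rewrite addr_ge0 ?sqr_ge0.
have HG : r / 2 * E * G <= bregman w m.
  by apply: le_trans HD; rewrite lerDr; apply: mulr_ge0; rewrite ?sqr_ge0// ltW.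
have T1 : `|A ^+ 2 - B ^+ 2| <= e / 2 * (A ^+ 2 + B ^+ 2) + (c * e)^-1 * bregman w m.
  apply: le_trans (_ : e / 2 * (A ^+ 2 + B ^+ 2) + e^-1 * (A - B) ^+ 2 <= _); last first.
    rewrite lerD2l invfM [c^-1 * _]mulrC -mulrA ler_wpM2l ?invr_ge0 ?(ltW e0)//.
    by rewrite ler_pdivlMl.
  have A0 : 0 <= A := powR_ge0 _ _; have B0 : 0 <= B := powR_ge0 _ _.
  have -> : A ^+ 2 - B ^+ 2 = (A - B) * (A + B) by ring.
  rewrite normrM (ger0_norm (addr_ge0 A0 B0)).
  rewrite -(real_normK (num_real (A - B))).
  set z := `|A - B|; rewrite -(ler_pM2l e0).
  have -> : e * (e / 2 * (A ^+ 2 + B ^+ 2) + e^-1 * z ^+ 2) =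
      e ^+ 2 / 2 * (A ^+ 2 + B ^+ 2) + z ^+ 2 by field; rewrite gt_eqF.
  have H1 := sqr_ge0 (z - e / 2 * (A + B)).
  have H2 : 0 <= e ^+ 2 * (A - B) ^+ 2 by rewrite mulr_ge0 ?sqr_ge0.
  by clear - H1 H2; nra.
have T2 : M * `|al `^ r - be `^ r| <= e / 2 * (A ^+ 2 + B ^+ 2) + 2 * r / e * bregman w m.
  apply: le_trans (_ : E * (r * d) <= _).
    apply: le_trans (ler_wpM2l M0 lip) _.
    by rewrite ler_wpM2r// mulr_ge0// ltW.
  apply: le_trans (_ : e / 2 * (A ^+ 2 + B ^+ 2) +
      2 * r / e * (r / 2 * E * G) <= _); last first.
    by rewrite lerD2l ler_wpM2l.
  apply: le_trans (_ : e / 2 * E + 2 * r / e * (r / 2 * E * d ^+ 2) <= _); last first.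
    apply: lerD.
      by rewrite ler_wpM2l ?divr_ge0 ?(ltW e0)// -(ler_pM2l r0).
    by rewrite ler_wpM2l// ler_wpM2l// mulr_ge0 ?divr_ge0 ?(ltW r0).
  have -> : e / 2 * E + 2 * r / e * (r / 2 * E * d ^+ 2) =
     E * (e / 2 + (r * d) ^+ 2 / e) by field; rewrite gt_eqF.
  rewrite ler_wpM2l// -(ler_pM2l e0).
  have -> : e * (e / 2 + (r * d) ^+ 2 / e) = e ^+ 2 / 2 + (r * d) ^+ 2.
    by field; rewrite gt_eqF.
  have H1 := sqr_ge0 (r * d - e / 2); have H2 := sqr_ge0 e.
  by clear - H1 H2; nra.
apply: le_trans (lerD T1 T2) _.
have : 0 <= (1 + (r - 1)^-1) * bregman w m by rewrite mulr_ge0// addr_ge0.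
lra.
Qed.

End bregman.

(** * Counting levels *)

Section level_counting.
Context {R : realType}.
Implicit Types (X m s : R) (a b K : nat).

Lemma sum_ltn_min a K : (\sum_(k < K) (k < a)%N)%N = minn K a.
Proof.
elim: K => [|K IH]; first by rewrite big_ord0 min0n.
by rewrite big_ord_recr/= IH; case: (ltnP K a) => [/=|/=] h; lia.
Qed.

Lemma sum_dist_ltn a b K : (a <= b)%N ->
  \sum_(k < K) `|(k < a)%N%:R - (k < b)%N%:R| <= (b - a)%:R :> R.
Proof.
move=> ab.
have -> : \sum_(k < K) `|(k < a)%N%:R - (k < b)%N%:R| =
    (\sum_(k < K) (k < b)%N)%:R - (\sum_(k < K) (k < a)%N)%:R :> R.
  rewrite !natr_sum -sumrB; apply: eq_bigr => k _.
  rewrite distrC ger0_norm// subr_ge0 ler_nat.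
  by case: (ltnP k a) => [/leq_trans/(_ ab)->|].
by rewrite !sum_ltn_min -natrB ?ler_nat; lia.
Qed.

Lemma ltn_truncn_div X s k : 0 < s ->
  (k < Num.truncn (X / s))%N = (k.+1%:R * s <= X).
Proof. by move=> s0; rewrite truncn_gt_nat ler_pdivlMr. Qed.

(* Discrete layer-cake formula with mesh [s]. *)
Lemma sum_level_dist X m s K : 0 < s -> 0 <= X -> 0 <= m ->
  s * \sum_(k < K) `|(k.+1%:R * s <= X)%R%:R - (k.+1%:R * s <= m)%R%:R|
    <= `|X - m| + s.
Proof.
move=> s0; wlog Xm : X m / X <= m => [W X0 m0|X0 m0].
  have [Xm|/ltW mX] := leP X m; first exact: W.
  rewrite distrC; under eq_bigr do rewrite distrC; exact: W.
have tr01 (Y : R) : 0 <= Y ->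
    (Num.truncn (Y / s))%:R * s <= Y < ((Num.truncn (Y / s)).+1)%:R * s.
  move=> Y0; rewrite -ler_pdivlMr// -ltr_pdivrMr//.
  by apply: truncn_itv; rewrite divr_ge0 ?(ltW s0).
have tr : (Num.truncn (X / s) <= Num.truncn (m / s))%N.
  by apply: le_truncn; rewrite ler_pM2r ?invr_gt0.
under eq_bigr do rewrite -!ltn_truncn_div//.
apply: le_trans (ler_wpM2l (ltW s0) (sum_dist_ltn K tr)) _.
rewrite natrB//; have /andP[_ hX] := tr01 X X0; have /andP[hm _] := tr01 m m0.
rewrite distrC ger0_norm ?subr_ge0//; move: hX; rewrite -natr1; lra.
Qed.

(** Rounding [X] down to a multiple of [s] loses at most [s], and [K] levels are enough to reach
    [X]. *)
Lemma level_sum_ge X s K : 0 < s -> 0 <= X -> X <= K%:R * s ->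
  X <= s * \sum_(k < K) (k.+1%:R * s <= X)%R%:R + s.
Proof.
move=> s0 X0 XK; under eq_bigr do rewrite -ltn_truncn_div//.
have : 0 <= X / s by rewrite divr_ge0 ?(ltW s0).
move=> /truncn_itv/andP[]; rewrite ler_pdivlMr// ltr_pdivrMr//.
set n := Num.truncn _ => nX Xn.
rewrite -natr_sum sum_ltn_min (_ : minn K n = n); last first.
  apply/minn_idPr; rewrite -(ler_nat R) -(ler_pM2r s0).
  exact: le_trans nX XK.
by move: Xn; rewrite -natr1; lra.
Qed.

End level_counting.

(** * Integrals of real functions *)

Section real_integrals.
Context {d : measure_display} {T : measurableType d} {R : realType}.
Variable mu : {finite_measure set T -> \bar R}.
Implicit Types f g : T -> R.

Definition rintegrable f := mu.-integrable setT (EFin \o f).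

Lemma rintegrableD f g :
  rintegrable f -> rintegrable g -> rintegrable (fun x => f x + g x).
Proof. exact: (integrableD measurableT). Qed.

Lemma rintegrableB f g :
  rintegrable f -> rintegrable g -> rintegrable (fun x => f x - g x).
Proof. exact: (integrableB measurableT). Qed.

Lemma rintegrableZ (c : R) f : rintegrable f -> rintegrable (fun x => c * f x).
Proof. exact: (integrableZl measurableT c). Qed.

Lemma rintegrable_cst (c : R) : rintegrable (fun=> c).
Proof. exact: finite_measure_integrable_cst. Qed.

Lemma rintegrable_indic (A : set T) : measurable A -> rintegrable \1_A.
Proof. exact: integrable_indic. Qed.

Lemma le_rintegrable f g : measurable_fun setT f ->
  (forall x, `|f x| <= g x) -> rintegrable g -> rintegrable f.
Proof.
move=> mf fg; apply: le_integrable => //; first exact/measurable_EFinP.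
by move=> x _; rewrite lee_fin (le_trans (fg x))// ler_norm.
Qed.

Lemma rintegrable_sum n (F : 'I_n -> T -> R) : (forall i, rintegrable (F i)) ->
  rintegrable (fun x => \sum_(i < n) F i x).
Proof.
move=> iF; rewrite /rintegrable (_ : _ \o _ = (fun x => \sum_(i < n) (F i x)%:E)%E).
  by apply: (integrable_sum measurableT) => i _; exact: iF.
by apply/funext => x /=; rewrite sumEFin.
Qed.

Lemma Rintegral_sum n (F : 'I_n -> T -> R) : (forall i, rintegrable (F i)) ->
  \int[mu]_x (\sum_(i < n) F i x) = \sum_(i < n) \int[mu]_x F i x.
Proof.
elim: n F => [|n IH] F iF.
  under eq_Rintegral do rewrite big_ord0.
  by rewrite Rintegral_cst// mul0r big_ord0.
under eq_Rintegral do rewrite big_ord_recr/=.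
rewrite big_ord_recr/= RintegralD ?IH//; last exact: iF.
exact: rintegrable_sum.
Qed.

Lemma Rintegral_indic (A : set T) : measurable A ->
  \int[mu]_x \1_A x = fine (mu A).
Proof. by move=> mA; rewrite /Rintegral integral_indic// setIT. Qed.

End real_integrals.

(** * Level sets and the Jensen gap for one probability measure *)

Section fibre.
Context {d : measure_display} {T : measurableType d} {R : realType}.
Variables (r : R) (r1 : 1 < r).
Implicit Types (f : T -> R[i]).

(** The thresholds start at [s], not at 0, so the number of levels containing [x] is the integer
    part of [repos r (f x) / s]. *)
Definition level f (s : R) (k : nat) : set T :=
  [set x | k.+1%:R * s <= repos r (f x)].

Lemma measurable_repos f : cmeasurable f ->
  measurable_fun setT (fun x => repos r (f x)).
Proof.
move=> [mf _]; apply: (measurableT_comp (measurable_powR r)).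
by apply: measurable_maxr => //; exact: measurable_cst.
Qed.

Lemma measurable_normcX f : cmeasurable f ->
  measurable_fun setT (fun x => normc (f x) `^ r).
Proof.
move=> mf; apply: (measurableT_comp (measurable_powR r)).
exact: measurable_normc.
Qed.

Lemma measurable_level f s k : cmeasurable f -> measurable (level f s k).
Proof.
move=> mf; rewrite (_ : level _ _ _ =
    setT `&` (fun x => repos r (f x)) @^-1` `[k.+1%:R * s, +oo[%classic).
  by apply: measurable_repos => //; exact: measurable_itv.
by apply/seteqP; split => x /=; rewrite in_itv/= andbT => -[].
Qed.

Variable pi : probability T R.

Let pi1 : fine (pi setT) = 1. Proof. by rewrite probability_setT. Qed.

(** The integral is the mass of [A] or of its complement, and each is at least their product. *)
Lemma mulr_onem_le_indic_dist (A : set T) (b : bool) : measurable A ->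
  fine (pi A) * (1 - fine (pi A)) <= \int[pi]_x `|\1_A x - b%:R|.
Proof.
move=> mA; have p01 : 0 <= fine (pi A) <= 1.
  by rewrite fine_ge0//= -lee_fin fineK ?fin_num_measure// probability_le1.
case: b => /=.
  under eq_Rintegral => x _.
    rewrite (_ : `|_| = 1 - \1_A x); first over.
    rewrite indicE; case: (x \in A);
      by rewrite /= ?subrr ?sub0r ?subr0 ?normrN ?normr0 ?normr1.
  rewrite RintegralB//; [|exact: rintegrable_cst|exact: rintegrable_indic].
  rewrite Rintegral_cst// Rintegral_indic//.
  have -> : fine (pi [set: T]) = 1 by [].
  nra.
under eq_Rintegral => x _.
  rewrite subr0 ger0_norm; first over.
  by rewrite indicE.
rewrite Rintegral_indic//; nra.
Qed.

Variables (f : T -> R[i]) (mf : cmeasurable f).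
Hypothesis intf : rintegrable pi (fun x => normc (f x) `^ r).
Let m := cintegral pi f.
Let I := \int[pi]_x (normc (f x) `^ r).

Let r0 : 0 < r. Proof. exact: lt_trans ltr01 r1. Qed.

Let int_normc : rintegrable pi (fun x => normc (f x)).
Proof.
apply: (@le_rintegrable _ _ _ _ _ (fun x => 1 + normc (f x) `^ r)).
- exact: measurable_normc.
- move=> x; rewrite ger0_norm ?normc_ge0//.
  have [n1|n1] := leP (normc (f x)) 1; first by rewrite ler_wpDr ?powR_ge0.
  apply: ler_wpDl => //; rewrite -[leLHS]powRr1 ?normc_ge0//.
  by apply: ler_powR; apply: ltW.
- by apply: rintegrableD => //; exact: rintegrable_cst.
Qed.

Let int_ReIm : rintegrable pi (Re \o f) /\ rintegrable pi (Im \o f).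
Proof.
apply: cintegrableP => //; have /integrableP[_] := int_normc.
apply: le_lt_trans; rewrite le_eqVlt; apply/orP; left; apply/eqP.
by apply: eq_integral => x _; rewrite /= ger0_norm ?normc_ge0.
Qed.

Let D x := bregman r (f x) m.

Let int_D : rintegrable pi D.
Proof.
have [iR iI] := int_ReIm.
rewrite /D /bregman; apply: rintegrableB.
  by apply: rintegrableB => //; exact: rintegrable_cst.
apply: rintegrableZ; apply: rintegrableD.
- under [X in rintegrable _ X]eq_fun do rewrite mulrC.
  by apply/rintegrableZ/rintegrableB => //; exact: rintegrable_cst.
- under [X in rintegrable _ X]eq_fun do rewrite mulrC.
  by apply/rintegrableZ/rintegrableB => //; exact: rintegrable_cst.
Qed.

Lemma Rintegral_bregman : \int[pi]_x D x = I - normc m `^ r.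
Proof.
have [iR iI] := int_ReIm.
have iR' : rintegrable pi (fun x => Re m * (Re (f x) - Re m)).
  by apply/rintegrableZ/rintegrableB => //; exact: rintegrable_cst.
have iI' : rintegrable pi (fun x => Im m * (Im (f x) - Im m)).
  by apply/rintegrableZ/rintegrableB => //; exact: rintegrable_cst.
rewrite /D /bregman.
under eq_Rintegral do rewrite [X in _ * (X + _)]mulrC [X in _ * (_ + X)]mulrC.
have ic c : rintegrable pi (fun=> c) := rintegrable_cst pi c.
rewrite RintegralB//; last 2 first.
- exact: rintegrableB.
- by apply: rintegrableZ; exact: rintegrableD.
rewrite RintegralB//; last exact: ic.
rewrite (@RintegralZl _ _ _ _ _ (fun x => Re m * (Re (f x) - Re m) +
  Im m * (Im (f x) - Im m)))//; last exact: rintegrableD.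
rewrite RintegralD//.
rewrite (@RintegralZl _ _ _ _ _ (fun x => Re (f x) - Re m))//; last exact: rintegrableB.
rewrite (@RintegralZl _ _ _ _ _ (fun x => Im (f x) - Im m))//; last exact: rintegrableB.
rewrite RintegralB//; last exact: ic.
rewrite RintegralB//; last exact: ic.
rewrite !Rintegral_cst//.
have -> : fine (pi [set: T]) = 1 by [].
rewrite !mulr1.
have -> : \int[pi]_x (Re \o f) x = Re m by [].
have -> : \int[pi]_x (Im \o f) x = Im m by [].
by rewrite !subrr !mulr0 addr0 mulr0 subr0.
Qed.

Lemma jensen_normc : normc m `^ r <= I.
Proof.
rewrite -subr_ge0 -Rintegral_bregman; apply: Rintegral_ge0 => x _.
exact: bregman_ge0.
Qed.

(** Each level set is compared with the truth value of its inequality at the mean [m]. The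
    layer-cake bound adds up these errors, the hypothesis passes to the divergence, and that
    integrates to the Jensen gap. Jensen's inequality absorbs the remaining power of [m], whence
    [2 * e]. *)
Lemma fibre_level_energy (e C s : R) K : 0 <= e -> 0 <= C -> 0 < s ->
  (forall w z, `|repos r w - repos r z| <=
    e * (normc w `^ r + normc z `^ r) + C * bregman r w z) ->
  s * (\sum_(k < K) fine (pi (level f s k)) * (1 - fine (pi (level f s k)))) +
    C * normc m `^ r <= (2 * e + C) * I + s.
Proof.
move=> e0 C0 s0 HC.
have ic c : rintegrable pi (fun=> c) := rintegrable_cst pi c.
pose b k := k.+1%:R * s <= repos r m.
have mL k : measurable (level f s k) by exact: measurable_level.
have iq k : rintegrable pi (fun x => `|\1_(level f s k) x - (b k)%:R|).
  apply: (@integrable_norm _ _ _ _ _ (fun x => \1_(level f s k) x - (b k)%:R)).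
  by apply: rintegrableB => //; exact: rintegrable_indic.
have H1 : \sum_(k < K) fine (pi (level f s k)) * (1 - fine (pi (level f s k))) <=
    \int[pi]_x (\sum_(k < K) `|\1_(level f s k) x - (b k)%:R|).
  rewrite Rintegral_sum; first by apply: ler_sum => k _; exact: mulr_onem_le_indic_dist.
  by move=> k; exact: iq.
have iB : rintegrable pi (fun x => e * (normc (f x) `^ r + normc m `^ r) + C * D x).
  by apply: rintegrableD; apply: rintegrableZ => //; exact: rintegrableD.
have H2 : s * \int[pi]_x (\sum_(k < K) `|\1_(level f s k) x - (b k)%:R|) <=
    \int[pi]_x (e * (normc (f x) `^ r + normc m `^ r) + C * D x + s).
  rewrite -RintegralZl//; last exact: rintegrable_sum.
  apply: le_Rintegral => //.
  - by apply: rintegrableZ; exact: rintegrable_sum.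
  - exact: rintegrableD.
  - move=> x _; rewrite [leLHS](_ : _ = s * \sum_(k < K)
      `|(k.+1%:R * s <= repos r (f x))%R%:R - (k.+1%:R * s <= repos r m)%R%:R|); last first.
      by congr (_ * _); apply: eq_bigr => k _; rewrite indicE mem_setE.
    apply: le_trans (sum_level_dist _ _ _ _) _; rewrite ?repos_ge0//.
    by rewrite lerD2r.
have iA : rintegrable pi (fun x => normc (f x) `^ r + normc m `^ r).
  exact: rintegrableD.
move: H2.
rewrite (@RintegralD _ _ _ _ _ (fun x => e * (normc (f x) `^ r + normc m `^ r) +
  C * D x) (fun=> s))//; last exact: ic.
rewrite (@RintegralD _ _ _ _ _ (fun x => e * (normc (f x) `^ r + normc m `^ r))
  (fun x => C * D x))//; [|exact: rintegrableZ..].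
rewrite (RintegralZl e)// (RintegralZl C)//.
rewrite RintegralD//; last exact: ic.
rewrite Rintegral_bregman !Rintegral_cst//.
have -> : fine (pi [set: T]) = 1 by [].
rewrite !mulr1 -/I => H2.
have H3 := ler_wpM2l (ltW s0) H1; have J := jensen_normc.
have := ler_wpM2l e0 J; lra.
Qed.

End fibre.

Section Lfun_integrable.
Context {d : measure_display} {T : measurableType d} {R : realType}.
Variable mu : {finite_measure set T -> \bar R}.
Implicit Types f : T -> R[i].

Lemma ge0_rintegrable (h : T -> R) : (forall x, 0 <= h x) ->
  measurable_fun setT h -> (\int[mu]_x (h x)%:E < +oo)%E -> rintegrable mu h.
Proof.
move=> h0 mh hy; apply/integrableP; split; first exact/measurable_EFinP.
apply: le_lt_trans hy; rewrite le_eqVlt; apply/orP; left; apply/eqP.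
by apply: eq_integral => x _; rewrite /= ger0_norm.
Qed.

Lemma rintegralE (h : T -> R) : rintegrable mu h ->
  (\int[mu]_x (h x)%:E = (\int[mu]_x h x)%:E)%E.
Proof. by move=> ih; rewrite fineK//; exact: integrable_fin_num ih. Qed.

Lemma cLnormE (r : R) f : 0 < r ->
  cLnorm mu r%:E f = ((\int[mu]_x (normc (f x) `^ r)%:E) `^ r^-1)%E.
Proof.
move=> r0; rewrite /cLnorm unlock; congr (_ `^ _)%E.
apply: eq_integral => x _; rewrite /= ger0_norm ?normc_ge0//.
Qed.

Lemma cLfun_rintegrable (r : R) f : 1 <= r -> f \in cLfun mu r%:E <->
  cmeasurable f /\ rintegrable mu (fun x => normc (f x) `^ r).
Proof.
move=> r1; have r0 : 0 < r by rewrite (lt_le_trans ltr01).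
split=> [/cLfunP[mf]|[mf int]].
  rewrite cLnormE// => lf; split => //; apply: ge0_rintegrable => //.
  - by move=> x; exact: powR_ge0.
  - exact: measurable_normcX.
  - by apply: lty_poweRy lf; rewrite invr_neq0// gt_eqF.
apply/cLfunP; split => //; rewrite cLnormE// rintegralE//.
exact: poweR_lty (ltry _).
Qed.

Lemma cLnorm_rintegral (r : R) f : 1 <= r -> f \in cLfun mu r%:E ->
  cLnorm mu r%:E f = ((\int[mu]_x (normc (f x) `^ r)) `^ r^-1)%:E.
Proof.
move=> r1; have r0 : 0 < r by rewrite (lt_le_trans ltr01).
by move=> /(cLfun_rintegrable _ r1)[mf int]; rewrite cLnormE// rintegralE// poweR_EFin.
Qed.

End Lfun_integrable.

(** * Energy of sets *)

Section energy.
Context {d : measure_display} {S : measurableType d} {R : realType}.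
Variables (mu : probability S R) (P : R.-pker S ~> S).
Hypothesis muP : bistochastic mu P.
Implicit Types A B : set S.

(** A copy of [P x] that carries a probability structure, so that the results on one probability
    measure apply in each fibre. *)
Definition step (x : S) : set S -> \bar R := P x.

HB.instance Definition _ x := Measure.on (step x).

Let step1 x : step x setT = 1%E. Proof. exact: prob_kernel. Qed.

HB.instance Definition _ x := Measure_isProbability.Build _ _ _ (step x) (step1 x).

Definition mass A : R := fine (mu A).

Definition hit A x : R := fine (step x A).

(* [\int hit A * (1 - hit A)] is the probability that two independent
   [P]-steps from a common [mu]-distributed point separate [A] from its
   complement. *)
Definition energy A : R := \int[mu]_x (hit A x * (1 - hit A x)).

Lemma hit01 A x : measurable A -> 0 <= hit A x <= 1.
Proof.
move=> mA; rewrite fine_ge0//= -lee_fin fineK ?fin_num_measure//.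
exact: probability_le1.
Qed.

Lemma measurable_hit A : measurable A -> measurable_fun setT (hit A).
Proof.
by move=> mA; apply: measurableT_comp => //; exact: measurable_kernel.
Qed.

Lemma rintegrable_bounded01 (h : S -> R) : measurable_fun setT h ->
  (forall x, 0 <= h x <= 1) -> rintegrable mu h.
Proof.
move=> mh h01; apply: (@le_rintegrable _ _ _ _ _ (fun=> 1)) => //.
  by move=> x; have /andP[h0 h1] := h01 x; rewrite ger0_norm.
exact: rintegrable_cst.
Qed.

Lemma rintegrable_hit A : measurable A -> rintegrable mu (hit A).
Proof.
move=> mA; apply: rintegrable_bounded01; first exact: measurable_hit.
by move=> x; exact: hit01.
Qed.

Lemma rintegrable_energy A : measurable A ->
  rintegrable mu (fun x => hit A x * (1 - hit A x)).
Proof.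
move=> mA; apply: rintegrable_bounded01.
  apply: measurable_funM; first exact: measurable_hit.
  by apply: measurable_funB; [exact: measurable_cst|exact: measurable_hit].
by move=> x; have := hit01 x mA; nra.
Qed.

Lemma energy_ge0 A : measurable A -> 0 <= energy A.
Proof.
move=> mA; apply: Rintegral_ge0 => x _; have := hit01 x mA; nra.
Qed.

Lemma hitC A x : measurable A -> hit (~` A) x = 1 - hit A x.
Proof.
move=> mA; rewrite /hit probability_setC// fineB//; exact: fin_num_measure.
Qed.

Lemma energyC A : measurable A -> energy (~` A) = energy A.
Proof.
move=> mA; apply: eq_Rintegral => x _; rewrite hitC//; ring.
Qed.

Lemma energyT : energy setT = 0.
Proof.
rewrite /energy -[RHS](mul0r (fine (mu setT))) -Rintegral_cst//.
by apply: eq_Rintegral => x _; rewrite /hit probability_setT/= subrr mulr0.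
Qed.

(** If one of two points lies in the intersection and the other does not, the other misses [A] or
    [B], so [A] or [B] already separates the pair. *)
Lemma energyI A B : measurable A -> measurable B ->
  energy (A `&` B) <= energy A + energy B.
Proof.
move=> mA mB; have mAB : measurable (A `&` B) by exact: measurableI.
have mAD : measurable (A `\` B) by exact: measurableD.
have mBD : measurable (B `\` A) by exact: measurableD.
rewrite /energy -RintegralD//; [|exact: rintegrable_energy..].
apply: le_Rintegral => //; first exact: rintegrable_energy.
  by apply: rintegrableD; exact: rintegrable_energy.
move=> x _.
have hU C D : measurable C -> measurable D -> C `&` D = set0 ->
    hit (C `|` D) x = hit C x + hit D x.
  move=> mC mD CD; rewrite /hit measureU//.
  by rewrite fineD//; exact: fin_num_measure.
have EA : hit A x = hit (A `&` B) x + hit (A `\` B) x.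
  rewrite -hU//; last by apply/seteqP; split => y /=; tauto.
  by congr (hit _ x); apply/seteqP; split => y /=; have := pselect (B y); tauto.
have EB : hit B x = hit (A `&` B) x + hit (B `\` A) x.
  rewrite -hU//; last by apply/seteqP; split => y /=; tauto.
  by congr (hit _ x); apply/seteqP; split => y /=; have := pselect (A y); tauto.
have EU : hit (A `|` (B `\` A)) x = hit A x + hit (B `\` A) x.
  by rewrite hU//; apply/seteqP; split => y /=; tauto.
have /andP[_ ] := hit01 x (measurableU _ _ mA mBD); rewrite EU EA => U1.
have /andP[a0 _] := hit01 x mAB; have /andP[b0 _] := hit01 x mAD.
have /andP[c0 _] := hit01 x mBD.
rewrite EB.
move: a0 b0 c0 U1; set a := hit _ x; set b := hit (A `\` B) x.
set c := hit (B `\` A) x; nra.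
Qed.

Lemma Rintegral_hit A : measurable A -> \int[mu]_x hit A x = mass A.
Proof.
move=> mA; rewrite /mass -muP//; congr fine; apply: eq_integral => x _.
by rewrite fineK// fin_num_measure.
Qed.

End energy.

(** * Small sets are not almost invariant *)

Section small_sets.
Context {d : measure_display} {S : measurableType d} {R : realType}.
Variables (mu : probability S R) (P : R.-pker S ~> S).
Hypothesis muP : bistochastic mu P.

(** An infinite [q] is lowered to [p + 1], which is allowed because [mu] is finite. *)
Lemma hyperbounded_fin : hyperbounded mu P -> exists p q : R, [/\ 1 < p, p < q &
  forall f, f \in cLfun mu p%:E -> markov P f \in cLfun mu q%:E].
Proof.
move=> [[p| |] [[q| |] [p1 pq Pf]]]//; first by exists p, q.
exists p, (p + 1); rewrite ltrDl ltr01; split => // f /Pf /cLfunP[mg lg].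
have g : normc \o markov P f \in Lfun mu +oo%E.
  by apply/andP; split; rewrite inE//; exact: measurable_normc.
have p11 : (1 <= (p + 1)%:E)%E by rewrite lee_fin lerDr ltW// (lt_trans ltr01).
have muT : mu setT \is a fin_num by rewrite probability_setT.
have /andP[_] := Lfun_subset p11 (leey _) muT (leey _) g.
by rewrite inE => lg'; apply/cLfunP.
Qed.

(** The bracket equals [h * (2 * h - 1)], which is nonpositive up to 1/2 and at most 1 beyond. For
    [h = hit P A x] its correction term integrates to twice the energy. *)
Lemma powR_bernoulli_lower (h q : R) : 0 <= q -> 0 <= h <= 1 ->
  2^-1 `^ q * (h - 2 * (h * (1 - h))) <= h `^ q.
Proof.
move=> q0 /andP[h0 h1]; have [hh|hh] := leP h 2^-1.
  apply: le_trans (powR_ge0 h q); apply: mulr_ge0_le0; first exact: powR_ge0.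
  nra.
apply: le_trans (_ : 2^-1 `^ q <= _).
  rewrite ler_piMr ?powR_ge0//; nra.
by apply: ge0_ler_powR => //; rewrite ?nnegrE ?ltW.
Qed.

Lemma mass_ge0 A : 0 <= mass mu A.
Proof. exact: fine_ge0. Qed.

Lemma massE A : measurable A -> (mass mu A)%:E = mu A.
Proof. by move=> mA; rewrite fineK//; exact: fin_num_measure. Qed.

Lemma almost_invariant_hit_powR (q : R) A : 0 <= q -> measurable A ->
  4 * energy mu P A < mass mu A ->
  2^-1 `^ q * (mass mu A / 2) <= \int[mu]_x (hit P A x `^ q).
Proof.
move=> q0 mA eA.
have iq : rintegrable mu (fun x => hit P A x `^ q).
  apply: rintegrable_bounded01.
    by apply: (measurableT_comp (measurable_powR q)); exact: measurable_hit.
  move=> x; rewrite powR_ge0/=; have /andP[h0 h1] := hit01 P x mA.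
  by apply: le_trans (ge0_ler_powR _ _ _ h1) _; rewrite ?nnegrE ?powR1.
have ih := rintegrable_hit mu P mA; have ie := rintegrable_energy mu P mA.
have ie2 := rintegrableZ 2 ie.
apply: le_trans (_ : \int[mu]_x (2^-1 `^ q *
  (hit P A x - 2 * (hit P A x * (1 - hit P A x)))) <= _); last first.
  apply: le_Rintegral => //; first by apply/rintegrableZ/rintegrableB.
  by move=> x _; apply: powR_bernoulli_lower => //; exact: hit01.
rewrite RintegralZl//; last exact: rintegrableB.
rewrite ler_wpM2l ?powR_ge0// RintegralB// RintegralZl// Rintegral_hit//.
move: eA; rewrite /energy; lra.
Qed.

Definition lift_real (h : S -> R) : S -> R[i] := fun x => Complex (h x) 0.

Lemma normc_real (a : R) : 0 <= a -> normc (Complex a 0) = a.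
Proof. by move=> a0; rewrite /= expr0n/= addr0 sqrtr_sqr ger0_norm. Qed.

Lemma cmeasurable_lift_real h : measurable_fun setT h -> cmeasurable (lift_real h).
Proof. by move=> mh; split; [exact: mh|exact: measurable_cst]. Qed.

(** Positivity of the Markov operator: the image of a superposition is bounded below by that of any
    single term. *)
Lemma markov_ge_hit (h : S -> R) (c : R) A : measurable A -> 0 <= c ->
  measurable_fun setT h -> (forall x, 0 <= h x) -> lift_real h \in cLfun mu 1 ->
  {ae mu, forall x, c * \1_A x <= h x} ->
  {ae mu, forall x, c * hit P A x <= normc (markov P (lift_real h) x)}.
Proof.
move=> mA c0 mh h0 hL /(bistochastic_ae muP).
apply: filterS2 (cLfun_ae_integrable muP (lexx _) hL) => x hy hA.
apply: le_trans (_ : Re (markov P (lift_real h) x) <= _); last first.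
  exact: le_trans (ler_norm _) (Re_normc _).
have ih : rintegrable (step P x) h.
  apply: ge0_rintegrable => //; apply: le_lt_trans hy.
  rewrite le_eqVlt; apply/orP; left; apply/eqP; apply: eq_integral => y _.
  by rewrite normc_real.
rewrite -lee_fin [leRHS](_ : _ = \int[step P x]_y (h y)%:E)%E; last first.
  by rewrite rintegralE.
have -> : (c * hit P A x)%:E = (\int[step P x]_y (c * \1_A y)%:E)%E.
  rewrite rintegralE; last by apply: rintegrableZ; exact: rintegrable_indic.
  by rewrite RintegralZl ?Rintegral_indic//; exact: rintegrable_indic.
apply: ae_ge0_le_integral => //.
- by move=> y _; rewrite lee_fin mulr_ge0.
- apply/measurable_EFinP; apply: measurable_funM; first exact: measurable_cst.
  exact: measurable_indic.
- by move=> y _; rewrite lee_fin.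
- exact/measurable_EFinP.
- by apply: filterS hA => y hy' _; rewrite lee_fin.
Qed.

(** Otherwise there are almost invariant sets [B j] with masses [b j] as small as desired. Take [s]
    strictly between [1 / q] and [1 / p], and let the p-th power of [h] be the sum of the indicators
    of [B j] with weights b_j^(-sp). Then [h] is in L^p, as the b_j^(1-sp) are summable, while its
    image dominates b_j^(-s) times [hit P (B j)], whose q-th power has integral at least a constant
    times b_j^(1-sq), unbounded in [j]. *)
Lemma hyperbounded_small_sets : hyperbounded mu P -> exists2 a : R, 0 < a &
  forall A, measurable A -> mass mu A < a -> mass mu A <= 4 * energy mu P A.
Proof.
move=> /hyperbounded_fin[p [q [p1 pq PL]]]; apply: contrapT => noa.
have p0 : 0 < p by rewrite (lt_trans ltr01).
have q0 : 0 < q by rewrite (lt_trans p0).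
have bad (a : R) : 0 < a -> exists A, [/\ measurable A, mass mu A < a &
    4 * energy mu P A < mass mu A].
  move=> a0; apply: contrapT => nA; apply: noa; exists a => // A mA Aa.
  by rewrite leNgt; apply/negP => lA; apply: nA; exists A.
pose s := (q^-1 + p^-1) / 2.
have qp : q^-1 < p^-1 by rewrite ltf_pV2.
have sp : s * p < 1 by rewrite -ltr_pdivlMr// div1r /s; lra.
have sq : 1 < s * q by rewrite -ltr_pdivrMr// div1r /s; lra.
have s0 : 0 < s by rewrite divr_gt0// addr_gt0 ?invr_gt0.
have bad2 (j : nat) : exists A, [/\ measurable A, 0 < mass mu A,
    mass mu A `^ (1 - s * p) <= 1 / (2 ^ j.+1)%:R,
    j.+1%:R <= mass mu A `^ (1 - s * q) &
    4 * energy mu P A < mass mu A].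
  have x0 : 0 < ((1 / (2 ^ j.+1)%:R) : R) by rewrite divr_gt0// ltr0n expn_gt0.
  (* Since [1 - s * p] is positive and [1 - s * q] negative, both requirements on the mass are upper
     bounds. *)
  pose a := Num.min ((1 / (2 ^ j.+1)%:R) `^ (1 - s * p)^-1)
                    (j.+1%:R `^ (1 - s * q)^-1 : R).
  have a0 : 0 < a by rewrite lt_min !powR_gt0.
  have [A [mA Aa eA]] := bad a a0; exists A.
  have A0 : 0 < mass mu A.
    by apply: le_lt_trans eA; rewrite mulr_ge0// energy_ge0.
  have [Aa1 Aa2] : mass mu A <= (1 / (2 ^ j.+1)%:R) `^ (1 - s * p)^-1 /\
      mass mu A <= j.+1%:R `^ (1 - s * q)^-1.
    by move: Aa; rewrite lt_min => /andP[/ltW-> /ltW->].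
  split => //.
    have h1 : 0 <= 1 - s * p by rewrite subr_ge0 ltW.
    apply: le_trans (ge0_ler_powR h1 _ _ Aa1) _; rewrite ?nnegrE ?powR_ge0 ?(ltW A0)//.
    by rewrite -powRrM mulVf ?powRr1 ?(ltW x0)// gt_eqF// subr_gt0.
  rewrite -(opprB (s * q) 1) powRN -[leLHS]invrK lef_pV2 ?posrE ?powR_gt0 ?invr_gt0//.
  have h1 : 0 <= s * q - 1 by rewrite subr_ge0 ltW.
  apply: le_trans (ge0_ler_powR h1 _ _ Aa2) _; rewrite ?nnegrE ?powR_ge0 ?(ltW A0)//.
  rewrite -powRrM (_ : _ * _ = -1); last first.
    by rewrite -(opprB (s * q) 1) invrN mulNr mulVf// gt_eqF// subr_gt0.
  by rewrite powRN powRr1.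
have [B HB] := choice bad2.
have mB j : measurable (B j) by have [] := HB j.
pose b j := mass mu (B j).
have b0 j : 0 < b j by have [] := HB j.
pose H x := (\sum_(0 <= j <oo) (b j `^ (- (s * p)) * \1_(B j) x)%:E)%E.
have t0 j x : (0 <= (b j `^ (- (s * p)) * \1_(B j) x)%:E)%E.
  by rewrite lee_fin mulr_ge0// powR_ge0.
have mt j : measurable_fun setT (fun x => (b j `^ (- (s * p)) * \1_(B j) x)%:E).
  apply/measurable_EFinP; apply: measurable_funM; first exact: measurable_cst.
  exact: measurable_indic.
have H0 x : (0 <= H x)%E by apply: nneseries_ge0 => j _ _; exact: t0.
have mH : measurable_fun setT H.
  by apply: ge0_emeasurable_sum => [j x _ _|j _]; [exact: t0|exact: mt].
have intH : (\int[mu]_x H x <= 1)%E.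
  rewrite integral_nneseries//.
  apply: le_trans (@epsilon_trick0 R 1 xpredT ler01).
  apply: lee_nneseries => [j _ _|j _]; first exact: integral_ge0.
  rewrite rintegralE; last by apply: rintegrableZ; exact: rintegrable_indic.
  rewrite RintegralZl ?Rintegral_indic//; last exact: rintegrable_indic.
  rewrite lee_fin -/(mass mu (B j)) -[X in _ * X]powRr1 ?(ltW (b0 j))//.
  rewrite -powRD; last by rewrite (gt_eqF (b0 j)) implybT.
  by rewrite addrC; have [_ _ + _ _] := HB j.
(* [fine] sends an infinite value to 0, so lower bounds on [h] hold only where [H] is finite. *)
have aeH : {ae mu, forall x, H x \is a fin_num}.
  have : mu.-integrable setT H.
    apply/integrableP; split => //.
    under eq_integral do rewrite gee0_abs//.
    exact: le_lt_trans intH (ltry _).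
  by move/(integrable_ae measurableT); apply: filterS => x; apply.
pose h x := fine (H x) `^ p^-1.
have h0 x : 0 <= h x by exact: powR_ge0.
have mh : measurable_fun setT h.
  apply: (measurableT_comp (measurable_powR _)).
  exact: measurableT_comp.
have hp x : h x `^ p = fine (H x).
  by rewrite -powRrM mulVf ?gt_eqF// powRr1// fine_ge0.
have hL : lift_real h \in cLfun mu p%:E.
  apply/cLfun_rintegrable; first exact: ltW.
  split; first exact: cmeasurable_lift_real.
  apply: ge0_rintegrable => //.
  - by move=> x; exact: powR_ge0.
  - exact/measurable_normcX/cmeasurable_lift_real.
  - apply: le_lt_trans (ltry 1); apply: le_trans intH.
    apply: ge0_le_integral => //.
    + by move=> x _; rewrite lee_fin powR_ge0.
    + exact/measurable_EFinP/measurable_normcX/cmeasurable_lift_real.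
    + move=> x _; rewrite normc_real// hp.
      by have := H0 x; case: (H x) => //= *; rewrite leey.
have hL1 : lift_real h \in cLfun mu 1.
  have /cLfunP[mhc lh] := hL.
  have g : normc \o lift_real h \in Lfun mu p%:E.
    by apply/andP; split; rewrite inE//; exact: measurable_normc.
  have muT : mu setT \is a fin_num by rewrite probability_setT.
  have p1' : (1 <= p%:E)%E by rewrite lee_fin ltW.
  have /andP[_] := Lfun_subset (lexx _) p1' muT p1' g.
  by rewrite inE => lg'; apply/cLfunP.
have := PL _ hL; rewrite cLfun_rintegrable ?(ltW (lt_trans p1 pq))// => -[mg ig].
pose M := \int[mu]_x (normc (markov P (lift_real h) x) `^ q).
suff bound j : j.+1%:R * (2^-1 `^ q / 2) <= M.
  have c0 : 0 < 2^-1 `^ q / 2 :> R by rewrite divr_gt0 ?powR_gt0.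
  have := bound (Num.truncn (M / (2^-1 `^ q / 2))).
  rewrite -ler_pdivlMr// leNgt => /negP; apply.
  have : 0 <= M / (2^-1 `^ q / 2).
    by rewrite divr_ge0 ?(ltW c0)//; apply: Rintegral_ge0 => x _; exact: powR_ge0.
  by move=> /truncn_itv/andP[].
have [_ _ _ bj eB] := HB j.
have iq : rintegrable mu (fun x => hit P (B j) x `^ q).
  apply: rintegrable_bounded01.
    by apply: (measurableT_comp (measurable_powR q)); exact: measurable_hit.
  move=> x; rewrite powR_ge0/=; have /andP[hh0 hh1] := hit01 P x (mB j).
  by apply: le_trans (ge0_ler_powR (ltW q0) _ _ hh1) _; rewrite ?nnegrE ?powR1.
have aeh : {ae mu, forall x, b j `^ (- s) * \1_(B j) x <= h x}.
  apply: filterS aeH => x Hx.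
  rewrite -(@powRr1 _ (h x))// -(mulfV (lt0r_neq0 p0)) powRrM hp.
  have -> : b j `^ (- s) * \1_(B j) x = (b j `^ (- (s * p)) * \1_(B j) x) `^ p^-1.
    rewrite indicE; case: (x \in B j); rewrite ?mulr1 ?mulr0.
      by rewrite -powRrM mulNr -mulrA mulfV ?mulr1 ?gt_eqF.
    by rewrite powR0// invr_neq0// gt_eqF.
  apply: ge0_ler_powR; rewrite ?nnegrE ?invr_ge0 ?(ltW p0) ?fine_ge0//.
    by rewrite mulr_ge0 ?powR_ge0.
  rewrite -lee_fin fineK//.
  have := @nneseries_lim_ge R _ xpredT 0 j.+1 (fun j _ _ => t0 j x).
  apply: le_trans; rewrite big_nat_recr//= leeDr// sume_ge0// => i _; exact: t0.
have aePh := markov_ge_hit (mB j) (powR_ge0 _ _) mh h0 hL1 aeh.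
have : (b j `^ (- s)) `^ q * \int[mu]_x (hit P (B j) x `^ q) <= M.
  rewrite -RintegralZl// -lee_fin -!rintegralE//; last exact: rintegrableZ.
  apply: ae_ge0_le_integral => //.
  - by move=> x _; rewrite lee_fin mulr_ge0 ?powR_ge0.
  - by have /integrableP[] := rintegrableZ ((b j `^ (- s)) `^ q) iq.
  - by move=> x _; rewrite lee_fin powR_ge0.
  - by have /integrableP[] := ig.
  apply: filterS aePh => x hx _; rewrite lee_fin -powRM ?powR_ge0 ?fine_ge0//.
  apply: ge0_ler_powR; rewrite ?nnegrE ?(ltW q0) ?normc_ge0//.
  by rewrite mulr_ge0 ?powR_ge0 ?fine_ge0.
apply: le_trans; apply: le_trans (ler_wpM2l (powR_ge0 _ _) _); last first.
  exact: almost_invariant_hit_powR (ltW q0) (mB j) eB.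
rewrite -/(b j) -powRrM.
have -> : b j `^ (- s * q) * (2^-1 `^ q * (b j / 2)) =
    (b j `^ (1 - s * q)) * (2^-1 `^ q / 2).
  rewrite mulNr powRD; last by rewrite (gt_eqF (b0 j)) implybT.
  by rewrite powRr1 ?(ltW (b0 j))//; ring.
by rewrite ler_wpM2r// divr_ge0 ?powR_ge0.
Qed.

End small_sets.

(** * Partitions into almost invariant cells *)

Section almost_invariant_partition.
Context {d : measure_display} {S : measurableType d} {R : realType}.
Variables (mu : probability S R) (P : R.-pker S ~> S).
Hypothesis muP : bistochastic mu P.
Implicit Types (c : S -> nat) (A B : set S).

Local Notation mass := (mass mu).
Local Notation energy := (energy mu P).

(** A partition is encoded by a labelling [c] of the points: disjointness is automatic, and cutting
    a cell means relabelling a part of it. *)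
Definition cell c i : set S := [set x | c x = i].

Definition measurable_cells c := forall i, measurable (cell c i).

Lemma indic_cell c i x : (\1_(cell c i) x = (c x == i)%:R :> R).
Proof.
rewrite indicE; congr (nat_of_bool _)%:R.
by apply/idP/eqP => [/set_mem//|cx]; exact/mem_set.
Qed.

Lemma massT : mass setT = 1.
Proof. exact: (congr1 fine (probability_setT mu)). Qed.

Lemma sum_mass_cell c N : measurable_cells c -> (forall x, (c x < N)%N) ->
  \sum_(i < N) mass (cell c i) = 1.
Proof.
move=> mc cN.
transitivity (\sum_(i < N) \int[mu]_x \1_(cell c i) x).
  by apply: eq_bigr => i _; rewrite Rintegral_indic.
rewrite -Rintegral_sum; last by move=> i; exact: rintegrable_indic.
transitivity (\int[mu]_x (1 : R)).
  apply: eq_Rintegral => x _; rewrite (bigD1 (Ordinal (cN x)))//=.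
  rewrite indic_cell eqxx big1 ?addr0// => i ix; rewrite indic_cell.
  case: eqVneq => // cx; move: ix; rewrite -val_eqE/= cx eqxx.
  by [].
by rewrite Rintegral_cst// mul1r; exact: massT.
Qed.

(** For positive [dl] the strict inequality excludes null cells, energies being nonnegative. *)
Definition almost_invariant_cells (dl : R) N c :=
  [/\ measurable_cells c, forall x, (c x < N)%N &
      forall i, (i < N)%N -> energy (cell c i) < dl * mass (cell c i)].

(** If [B] cut a cell into two pieces both heavier than the bound in [H], then by [energyI] each
    piece would have energy below [dl] times its own mass, and cutting there would give [N.+1]
    almost invariant cells. The bounds for single cells add up because the masses have sum 1. *)
Lemma unrefinable_isoperimetry (k dl : R) N c : 0 < k <= 1 -> 0 < dl ->
  almost_invariant_cells (k * dl) N c ->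
  ~ (exists c', almost_invariant_cells dl N.+1 c') ->
  forall B, measurable B ->
  \sum_(i < N) Num.min (mass (cell c i `&` B)) (mass (cell c i `\` B)) <=
    k + N%:R / dl * energy B.
Proof.
move=> /andP[k0 k1] dl0 [mc cN ec] nref B mB.
suff H (i : 'I_N) : Num.min (mass (cell c i `&` B)) (mass (cell c i `\` B)) <=
    k * mass (cell c i) + energy B / dl.
  apply: (@le_trans _ _ (\sum_(i < N) (k * mass (cell c i) + energy B / dl))).
    by apply: ler_sum => i _; exact: H.
  rewrite big_split/= -mulr_sumr sum_mass_cell// sumr_const card_ord mulr1.
  have -> : energy B / dl *+ N = N%:R / dl * energy B.
    by rewrite -mulr_natl mulrA mulrAC.
  exact: lexx.
rewrite leNgt; apply/negP; rewrite lt_min => /andP[H1 H2]; apply: nref.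
have e0 := ec i (ltn_ord i).
have E : dl * (energy B / dl) = energy B by rewrite mulrC divfK ?gt_eqF.
have m1 : measurable (cell c i `&` B) by exact: measurableI.
have m2 : measurable (cell c i `\` B) by exact: measurableD.
have b1 : energy (cell c i `&` B) < dl * mass (cell c i `&` B).
  apply: le_lt_trans (energyI mu P (mc i) mB) _.
  by move: H1; rewrite -(ltr_pM2l dl0) mulrDr E; lra.
have b2 : energy (cell c i `\` B) < dl * mass (cell c i `\` B).
  rewrite setDE; apply: le_lt_trans (energyI mu P (mc i) (measurableC mB)) _.
  rewrite energyC// -setDE.
  by move: H2; rewrite -(ltr_pM2l dl0) mulrDr E; lra.
(* The piece inside [B] gets the fresh label [N]; the rest of the cell keeps [i]. *)
exists (fun x => if (c x == i) && (x \in B) then N else c x).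
have cellN : cell (fun x => if (c x == i) && (x \in B) then N else c x) N =
    cell c i `&` B.
  apply/seteqP; split => x; rewrite /cell/=.
    case: ifPn => [/andP[/eqP ? /set_mem ?] //|_ cx].
    by move: (cN x); rewrite cx ltnn.
  by move=> [/eqP-> /mem_set->].
have celli : cell (fun x => if (c x == i) && (x \in B) then N else c x) i =
    cell c i `\` B.
  apply/seteqP; split => x; rewrite /cell/=.
    case: ifPn => [_ Ni|/nandP[/eqP//|/negP nB] ?].
      by have := ltn_ord i; rewrite -Ni ltnn.
    by split => // /mem_set.
  move=> [cx nB]; rewrite ifF//; apply/negbTE/nandP; right.
  by apply/negP => /set_mem.
have cellk l : l != N -> l != i ->
    cell (fun x => if (c x == i) && (x \in B) then N else c x) l = cell c l.
  move=> lN li; apply/seteqP; split => x; rewrite /cell/=.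
    by case: ifPn => // _ Nl; rewrite Nl eqxx in lN.
  by move=> cx; rewrite cx (negbTE li).
split.
- move=> l; have [->|lN] := eqVneq l N; first by rewrite cellN.
  have [->|li] := eqVneq l i; first by rewrite celli.
  by rewrite cellk.
- by move=> x; case: ifP => // _; rewrite ltnS ltnW.
- move=> l lN1; have [->|lN] := eqVneq l N; first by rewrite cellN.
  have [->|li] := eqVneq l i; first by rewrite celli.
  rewrite cellk//; have lN' : (l < N)%N by rewrite ltn_neqAle lN -ltnS.
  apply: lt_le_trans (ec l lN') _.
  by rewrite ler_wpM2r ?mass_ge0// ler_piMl// ltW.
Qed.

(* Each failure to find a good partition produces one with one more almost
   invariant cell, and small sets are not almost invariant, so the number of
   cells is bounded. *)
Lemma isoperimetric_partition (a k : R) : 0 < a -> 0 < k ->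
  (forall A, measurable A -> mass A < a -> mass A <= 4 * energy A) ->
  exists N c (L : R), [/\ 0 <= L, measurable_cells c, forall x, (c x < N)%N,
    forall i, (i < N)%N -> 0 < mass (cell c i) &
    forall B, measurable B ->
    \sum_(i < N) Num.min (mass (cell c i `&` B)) (mass (cell c i `\` B)) <=
      k + L * energy B].
Proof.
move=> a0 k0 small; apply: contrapT => nex.
pose k1 := Num.min k 1.
have k10 : 0 < k1 by rewrite lt_min k0 ltr01.
have k1k : k1 <= k by rewrite ge_min lexx.
have k11 : k1 <= 1 by rewrite ge_min lexx orbT.
pose M := (Num.truncn (a^-1)).+1.
have Ma : 1 < M%:R * a.
  rewrite -ltr_pdivrMr// div1r.
  have : 0 <= a^-1 by rewrite invr_ge0 ltW.
  by move=> /truncn_itv/andP[].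
(* Every new cell loosens the rate by the factor [k1^-1]; the exponent is such that the rate is 1/4
   when there are [M] cells. *)
have H n : (n < M)%N -> exists c, almost_invariant_cells (k1 ^+ (M - n.+1) / 4) n.+1 c.
  elim: n => [_|n IH nM].
    exists (fun=> 0%N).
    have c0 : cell (fun=> 0%N) 0 = setT by apply/seteqP; split.
    split => //.
    - move=> i; have [->|i0] := eqVneq i 0%N; first by rewrite c0.
      rewrite (_ : cell _ _ = set0)//; apply/seteqP; split => x//=.
      by rewrite /cell/= => i0'; rewrite -i0' in i0.
    - move=> [|//] _; rewrite c0 energyT.
      by rewrite massT mulr1 divr_gt0 ?exprn_gt0.
  have [c Hc] := IH (ltnW nM).
  have E : k1 ^+ (M - n.+1) / 4 = k1 * (k1 ^+ (M - n.+2) / 4).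
    by rewrite mulrA -exprS; congr (k1 ^+ _ / 4); lia.
  rewrite E in Hc; apply: contrapT => nref; apply: nex.
  have dl0 : 0 < k1 ^+ (M - n.+2) / 4 by rewrite divr_gt0 ?exprn_gt0.
  exists n.+1, c, (n.+1%:R / (k1 ^+ (M - n.+2) / 4)).
  have iso := @unrefinable_isoperimetry k1 _ _ _ _ dl0 Hc nref.
  have [mc cN ec] := Hc; split => //.
  - by rewrite divr_ge0// ltW.
  - move=> i /ec; have := energy_ge0 mu P (mc i); have := mass_ge0 mu (cell c i).
    move=> m0 e0 /(le_lt_trans e0); rewrite pmulr_rgt0//.
    by rewrite mulr_gt0.
  - move=> B mB; apply: le_trans (iso _ B mB) _; first by rewrite k10.
    by rewrite lerD2r.
(* At rate 1/4 the hypothesis [small] forces each of the [M] cells to have mass at least [a], so the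
   total mass would exceed 1. *)
have [c [mc cN ec]] := H M.-1 (leqnn _).
have := sum_mass_cell mc cN.
have : \sum_(i < M) a <= \sum_(i < M) mass (cell c i).
  apply: ler_sum => i _; rewrite leNgt; apply/negP => /(small _ (mc i)).
  have := ec i (ltn_ord i); rewrite subnn expr0; lra.
rewrite sumr_const card_ord -mulr_natl => /[swap] ->.
by rewrite leNgt Ma.
Qed.

End almost_invariant_partition.

(** * Functions whose norm is almost preserved *)

Section level_energy.
Context {d : measure_display} {S : measurableType d} {R : realType}.
Variables (mu : probability S R) (P : R.-pker S ~> S).
Hypothesis muP : bistochastic mu P.

Lemma ae_le_Rintegral (f g : S -> R) : rintegrable mu f -> rintegrable mu g ->
  (forall x, 0 <= f x) -> (forall x, 0 <= g x) ->
  {ae mu, forall x, f x <= g x} -> \int[mu]_x f x <= \int[mu]_x g x.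
Proof.
move=> rf rg f0 g0 fg; rewrite -lee_fin -!rintegralE//.
apply: ae_ge0_le_integral => //.
- by move=> x _; rewrite lee_fin.
- by have /integrableP[] := rf.
- by move=> x _; rewrite lee_fin.
- by have /integrableP[] := rg.
- by apply: filterS fg => x fgx _; rewrite lee_fin.
Qed.

(** Tonelli's theorem and invariance. The inner real integral is 0 by default where it diverges,
    which happens only on a null set. *)
Lemma step_average (h : S -> R) : (forall x, 0 <= h x) -> rintegrable mu h ->
  [/\ {ae mu, forall x, rintegrable (step P x) h},
      rintegrable mu (fun x => \int[step P x]_y h y) &
      \int[mu]_x \int[step P x]_y h y = \int[mu]_x h x].
Proof.
move=> h0 ih; have mh : measurable_fun setT (EFin \o h) by have /integrableP[] := ih.
pose W x := (\int[P x]_y (h y)%:E)%E.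
have W0 x : (0 <= W x)%E by apply: integral_ge0 => y _; rewrite lee_fin.
have mW : measurable_fun setT W.
  apply: measurable_fun_integral_kernel; [exact: measurable_kernel| |exact: mh].
  by move=> y; rewrite lee_fin.
have EW : (\int[mu]_x W x = (\int[mu]_x h x)%:E)%E.
  rewrite -rintegralE//; exact: (bistochastic_integral muP).
have iW : mu.-integrable setT W.
  apply/integrableP; split => //.
  under eq_integral do rewrite gee0_abs//.
  by rewrite EW ltry.
have aeW : {ae mu, forall x, W x \is a fin_num}.
  by have := integrable_ae measurableT iW; apply: filterS => x; apply.
have mfW : measurable_fun setT (fun x => \int[step P x]_y h y).
  by apply: (measurableT_comp _ mW).
have EfW : (\int[mu]_x (\int[step P x]_y h y)%:E = (\int[mu]_x h x)%:E)%E.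
  rewrite -EW; apply: ae_eq_integral => //; first exact/measurable_EFinP.
  by apply: filterS aeW => x Wx _; rewrite fineK.
split.
- apply: filterS aeW => x Wx; apply: ge0_rintegrable => //.
    exact/measurable_EFinP.
  by move: Wx; rewrite ge0_fin_numE.
- apply: ge0_rintegrable => //; last by rewrite EfW ltry.
  by move=> x; exact: Rintegral_ge0.
- by rewrite /Rintegral EfW.
Qed.

Lemma rintegrable_markov (r : R) f : 1 <= r -> f \in cLfun mu r%:E ->
  rintegrable mu (fun x => normc (markov P f x) `^ r).
Proof.
move=> r1 fL; have := markov_cLfun muP (_ : (1 <= r%:E)%E) fL.
by move=> /(_ r1) /cLfun_rintegrable -/(_ r1)[].
Qed.

(** Integration of [fibre_level_energy] over the base point [x], the mean of [f] in the fibre being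
    [markov P f x]. *)
Lemma level_energy_sum (r e C s : R) f K : 1 < r -> 0 <= e -> 0 <= C -> 0 < s ->
  (forall w z : R[i], `|repos r w - repos r z| <=
    e * (normc w `^ r + normc z `^ r) + C * bregman r w z) ->
  f \in cLfun mu r%:E ->
  s * (\sum_(k < K) energy mu P (level r f s k)) +
    C * \int[mu]_x (normc (markov P f x) `^ r) <=
  (2 * e + C) * \int[mu]_x (normc (f x) `^ r) + s.
Proof.
move=> r1 e0 C0 s0 HC fL.
have [mf intf] := (cLfun_rintegrable mu f (ltW r1)).1 fL.
have ig := rintegrable_markov (ltW r1) fL.
have mL k : measurable (level r f s k) by exact: measurable_level.
have [aei iW EW] := step_average (fun x => powR_ge0 _ _) intf.
pose E x := \sum_(k < K) (hit P (level r f s k) x * (1 - hit P (level r f s k) x)).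
have iE : rintegrable mu E by apply: rintegrable_sum => k; exact: rintegrable_energy.
have E0 x : 0 <= E x.
  by apply: sumr_ge0 => k _; have := hit01 P x (mL k); nra.
have -> : s * (\sum_(k < K) energy mu P (level r f s k)) +
    C * \int[mu]_x (normc (markov P f x) `^ r) =
    \int[mu]_x (s * E x + C * normc (markov P f x) `^ r).
  rewrite RintegralD//; [|exact: rintegrableZ..].
  rewrite (RintegralZl s)// (RintegralZl C)//; congr (s * _ + _).
  by rewrite Rintegral_sum// => k; exact: rintegrable_energy.
have -> : (2 * e + C) * \int[mu]_x (normc (f x) `^ r) + s =
    \int[mu]_x ((2 * e + C) * \int[step P x]_y (normc (f y) `^ r) + s).
  rewrite RintegralD//; last 2 first.
  - exact: rintegrableZ.
  - exact: rintegrable_cst.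
  rewrite (RintegralZl (2 * e + C))// EW Rintegral_cst//.
  by congr (_ + _); rewrite -[LHS]mulr1; congr (_ * _); rewrite -[LHS](massT mu).
apply: ae_le_Rintegral.
- by apply: rintegrableD; exact: rintegrableZ.
- by apply: rintegrableD; [exact: rintegrableZ|exact: rintegrable_cst].
- by move=> x; rewrite addr_ge0// mulr_ge0 ?powR_ge0// ltW.
- move=> x; rewrite addr_ge0 ?(ltW s0)// mulr_ge0 ?addr_ge0 ?mulr_ge0//.
  by apply: Rintegral_ge0 => y _; exact: powR_ge0.
- by apply: filterS aei => x ix; exact: (fibre_level_energy r1 mf ix K e0 C0 s0 HC).
Qed.

End level_energy.

Section near_invariant.
Context {d : measure_display} {S : measurableType d} {R : realType}.
Variables (mu : probability S R) (P : R.-pker S ~> S).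
Hypothesis muP : bistochastic mu P.
Implicit Types (c : S -> nat).

Lemma measurable_cells_fun c : measurable_cells c -> forall T' (F : nat -> T') (A : set T'),
  measurable ((F \o c) @^-1` A).
Proof.
move=> mc T' F A; have -> : (F \o c) @^-1` A =
    \bigcup_(i in [set i | A (F i)]) cell c i.
  by apply/seteqP; split => [x Ax|x [i Ai /= ci]]; [exists (c x)|rewrite /= ci].
exact: bigcup_measurable.
Qed.

Lemma measurable_fun_cells c d' (T' : measurableType d') (F : nat -> T') :
  measurable_cells c -> measurable_fun setT (F \o c).
Proof. by move=> mc _ A mA; rewrite setTI; exact: measurable_cells_fun. Qed.

(** Majority vote: in each cell the indicator of [B] is replaced by its prevailing value, and the
    error set [G i] is the lighter piece. *)
Lemma majority_dist c N (B : set S) : measurable_cells c -> (forall x, (c x < N)%N) ->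
  measurable B ->
  \int[mu]_x `|\1_B x -
    (mass mu (cell c (c x) `\` B) < mass mu (cell c (c x) `&` B))%R%:R| =
  \sum_(i < N) Num.min (mass mu (cell c i `&` B)) (mass mu (cell c i `\` B)).
Proof.
move=> mc cN mB; pose b i := mass mu (cell c i `\` B) < mass mu (cell c i `&` B).
pose G (i : 'I_N) := if b i then cell c i `\` B else cell c i `&` B.
have mG i : measurable (G i).
  by rewrite /G; case: ifP => _; [exact: measurableD|exact: measurableI].
transitivity (\int[mu]_x \sum_(i < N) \1_(G i) x).
  apply: eq_Rintegral => x _; rewrite (bigD1 (Ordinal (cN x)))//= big1 ?addr0.
    have cx : x \in cell c (c x) by exact/mem_set.
    rewrite -/(b (c x)) /G/=; case: ifPn => _; rewrite !indicE.
      by rewrite in_setD cx; case: (x \in B); rewrite /= ?subrr ?sub0r ?normrN ?normr0 ?normr1.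
    by rewrite in_setI cx; case: (x \in B); rewrite /= ?subr0 ?normr0 ?normr1.
  move=> i ix; rewrite indicE memNset// => Gx.
  have : cell c i x by move: Gx; rewrite /G; case: ifP => _ [].
  by rewrite /cell/= => cx; move: ix; rewrite -val_eqE/= cx eqxx.
rewrite Rintegral_sum; last by move=> i; exact: rintegrable_indic.
apply: eq_bigr => i _; rewrite Rintegral_indic// /G -/(b i) minEle.
by rewrite -/(mass mu _) /b ltNge; case: leP.
Qed.

Lemma nneseries_le (u : nat -> \bar R) (b : \bar R) : (forall n, 0 <= u n)%E ->
  (forall K, \sum_(0 <= k < K) u k <= b)%E -> (\sum_(0 <= k <oo) u k <= b)%E.
Proof.
move=> u0 ub; apply: lime_le; first by apply: is_cvg_nneseries => n _ _.
exact: nearW.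
Qed.

Variable r : R.
Hypothesis r1 : 1 < r.

(** The level sets have total energy at most 2. Low ones are replaced by unions of cells, by
    majority vote and isoperimetry; high ones are small, so their mass is at most four times their
    energy, and they are replaced by the empty set. The layer-cake sum of the replacements is [g].
    The partition is fixed before the mesh and before [f]. *)
Lemma near_cells (a eta : R) : 0 < a -> 0 < eta ->
  (forall A, measurable A -> mass mu A < a -> mass mu A <= 4 * energy mu P A) ->
  exists N c (dl : R), [/\ 0 < dl, measurable_cells c, forall x, (c x < N)%N,
    forall i, (i < N)%N -> 0 < mass mu (cell c i) &
    forall f, f \in cLfun mu r%:E -> \int[mu]_x (normc (f x) `^ r) = 1 ->
      1 - dl <= \int[mu]_x (normc (markov P f x) `^ r) ->
    exists2 g : nat -> R, forall i, 0 <= g i &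
      (\int[mu]_x `|repos r (f x) - g (c x)|%:E <= eta%:E)%E].
Proof.
move=> a0 eta0 small.
(* At most [1 / (s * a)] low levels incur this error, weighted by the mesh [s]: together at most
   [eta / 4]. *)
have k0 : 0 < eta * a / 4 by rewrite divr_gt0// mulr_gt0.
have [N [c [L [L0 mc cN mpos iso]]]] := isoperimetric_partition a0 k0 small.
(* The mesh error [s] and the energy cost [2 * (L + 4) * s] together stay below [eta / 2]. *)
pose s := eta / (4 * (L + 5)).
have L5 : 0 < 4 * (L + 5) by rewrite mulr_gt0// ltr_wpDl.
have s0 : 0 < s by rewrite divr_gt0.
have s40 : 0 < s / 4 by rewrite divr_gt0.
have [C C0 HC] := repos_bregman r1 s40.
(* This gives [C * dl <= s / 2], which with [e = s / 4] bounds the total energy by 2. *)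
pose dl := s / (2 * (C + 1)).
have C1 : 0 < 2 * (C + 1) by rewrite mulr_gt0// ltr_wpDl.
exists N, c, dl; split => //; first by rewrite divr_gt0.
move=> f fL f1 Pf1.
have [mf intf] := (cLfun_rintegrable mu f (ltW r1)).1 fL.
pose B k := level r f s k; have mB k : measurable (B k) by exact: measurable_level.
have massI k : mass mu (B k) = \int[mu]_x \1_(B k) x.
  by rewrite Rintegral_indic.
have eK K : \sum_(k < K) energy mu P (B k) <= 2.
  have := level_energy_sum muP K r1 (ltW s40) C0 s0 HC fL.
  rewrite f1 mulr1 -/B => H.
  rewrite -(ler_pM2l s0); set E := \sum_(k < K) _ in H *.
  have : C * dl <= s / 2.
    rewrite /dl mulrA ler_pdivrMr//.
    have -> : s / 2 * (2 * (C + 1)) = C * s + s by field.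
    by rewrite lerDl ltW.
  have := ler_wpM2l C0 Pf1; move: H; clear; lra.
(* By Markov's inequality level [k] has mass at most [1 / (k.+1%:R * s)], which is below [a] from
   [k1] on. *)
pose k1 := Num.truncn ((s * a)^-1).
have sa0 : 0 < s * a by rewrite mulr_gt0.
have k1le : k1%:R * (s * a) <= 1.
  rewrite -ler_pdivlMr// div1r.
  have : 0 <= (s * a)^-1 by rewrite invr_ge0 ltW.
  by move=> /truncn_itv/andP[].
have massB k : (k1 <= k)%N -> mass mu (B k) < a.
  move=> k1k; have : k.+1%:R * s * mass mu (B k) <= 1.
    rewrite massI -RintegralZl//; last exact: rintegrable_indic.
    apply: (@le_trans _ _ (\int[mu]_x (normc (f x) `^ r))); last by rewrite f1.
    apply: le_Rintegral => //.
      by apply: rintegrableZ; exact: rintegrable_indic.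
    move=> x _; rewrite indicE; case: (boolP (x \in B k)) => [/set_mem xB|_].
      have {}xB : k.+1%:R * s <= repos r (f x) by [].
      by rewrite mulr1; apply: le_trans xB _; exact: repos_le.
    by rewrite mulr0 powR_ge0.
  rewrite leNgt => /negP nb; rewrite ltNge; apply/negP => aB; apply: nb.
  apply: lt_le_trans (_ : k.+1%:R * s * a <= _); last first.
    by rewrite ler_wpM2l// mulr_ge0// ltW.
  rewrite -mulrA -ltr_pdivrMr// div1r.
  have : 0 <= (s * a)^-1 by rewrite invr_ge0 ltW.
  move=> /truncn_itv/andP[_ /lt_le_trans]; apply.
  by rewrite ler_nat ltnS.
pose D k i := (k < k1)%N && (mass mu (cell c i `\` B k) < mass mu (cell c i `&` B k)).
pose q k x : R := `|\1_(B k) x - (D k (c x))%:R|.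
have mq k : measurable_fun setT (q k).
  apply: measurableT_comp => //; apply: measurable_funB; first exact: measurable_indic.
  exact: (measurable_fun_cells (fun i => (D k i)%:R : R) mc).
have q01 k x : 0 <= q k x <= 1.
  rewrite /q normr_ge0/= indicE; case: (x \in B k); case: (D _ _);
    by rewrite ?subrr ?sub0r ?subr0 ?normrN ?normr0 ?normr1.
have q0 k x : 0 <= q k x by exact: normr_ge0.
have iq k : rintegrable mu (q k) by exact: rintegrable_bounded01.
have qk k : \int[mu]_x q k x <=
    (if (k < k1)%N then eta * a / 4 else 0) + (L + 4) * energy mu P (B k).
  have ek := energy_ge0 mu P (mB k); rewrite /q /D; case: ltnP => kk1 /=.
    rewrite (majority_dist mc cN (mB k)).
    apply: le_trans (iso _ (mB k)) _; by rewrite lerD2l ler_wpM2r// lerDl.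
  rewrite add0r; under eq_Rintegral do rewrite subr0 ger0_norm ?indicE//.
  have -> : \int[mu]_x (x \in B k)%:R = mass mu (B k) :> R.
    by rewrite massI; apply: eq_Rintegral => x _; rewrite indicE.
  apply: le_trans (small _ (mB k) (massB k kk1)) _.
  by rewrite ler_wpM2r// lerDr.
have qK K : \sum_(k < K) \int[mu]_x q k x <= k1%:R * (eta * a / 4) + (L + 4) * 2.
  apply: le_trans (ler_sum _ (fun (k : 'I_K) _ => qk k)) _.
  rewrite big_split/= -mulr_sumr; apply: lerD; last first.
    by apply: ler_wpM2l; [rewrite addr_ge0|exact: eK].
  have -> : \sum_(k < K) (if (k < k1)%N then eta * a / 4 else 0) =
      (\sum_(k < K) (k < k1)%N)%:R * (eta * a / 4) :> R.
    rewrite natr_sum mulr_suml; apply: eq_bigr => k _.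
    by case: ifP; rewrite ?mul1r ?mul0r.
  by rewrite ler_wpM2r ?(ltW k0)// ler_nat sum_ltn_min geq_minr.
pose g i : R := s * \sum_(k < k1) (D k i)%:R.
exists g.
  by move=> i; rewrite mulr_ge0 ?(ltW s0)// sumr_ge0.
have gK K i : (k1 <= K)%N -> g i = s * \sum_(k < K) (D k i)%:R.
  move=> k1K; rewrite /g; congr (s * _).
  rewrite -!(big_mkord xpredT (fun k => (D k i)%:R : R)) (big_cat_nat _ k1K)//=.
  rewrite [X in _ = _ + X]big_nat_cond [X in _ = _ + X]big1 ?addr0// => k.
  by rewrite andbT => /andP[kk _]; rewrite /D ltnNge kk.
(* The number of levels reached depends on [x] without a uniform bound, hence the series. *)
have pw x : (`|repos r (f x) - g (c x)|%:E <=
    s%:E + \sum_(0 <= k <oo) (s * q k x)%:E)%E.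
  set X := repos r (f x); have X0 : 0 <= X := repos_ge0 r _.
  pose K := maxn k1 (Num.truncn (X / s)).+1.
  apply: (@le_trans _ _ (s%:E + \sum_(0 <= k < K) (s * q k x)%:E)%E); last first.
    rewrite leeD2l//; apply: nneseries_lim_ge => k _ _.
    by rewrite lee_fin mulr_ge0 ?q0 ?(ltW s0).
  rewrite big_mkord sumEFin -EFinD lee_fin -mulr_sumr (gK K)//; last exact: leq_maxl.
  have XK : X <= K%:R * s.
    rewrite -ler_pdivrMr//.
    have : 0 <= X / s by rewrite divr_ge0 ?(ltW s0).
    move=> /truncn_itv/andP[_ /ltW/le_trans]; apply.
    by rewrite ler_nat leq_maxr.
  have H1 := level_sum_ge s0 X0 XK.
  have := @sum_level_dist R X 0 s K s0 X0 (lexx 0); rewrite subr0 ger0_norm//.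
  have -> : \sum_(k < K) `|(k.+1%:R * s <= X)%R%:R - (k.+1%:R * s <= 0)%R%:R| =
      \sum_(k < K) (k.+1%:R * s <= X)%R%:R :> R.
    apply: eq_bigr => k _.
    by rewrite [(_ <= 0)]leNgt mulr_gt0//= subr0 ger0_norm.
  move=> H2; pose I1 : R := \sum_(k < K) (k.+1%:R * s <= X)%R%:R.
  rewrite -/I1 in H1 H2.
  have -> : X - s * (\sum_(k < K) (D k (c x))%:R) =
      (X - s * I1) + s * (I1 - \sum_(k < K) (D k (c x))%:R) by ring.
  apply: le_trans (ler_normD _ _) _; apply: lerD.
    by rewrite ler_norml; move: H1 H2; clear; lra.
  rewrite normrM (ger0_norm (ltW s0)) ler_pM2l// /I1 -sumrB.
  apply: le_trans (ler_norm_sum _ _ _) _; apply: ler_sum => k _.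
  by rewrite /q indicE mem_setE.
have mg : measurable_fun setT (g \o c) by exact: measurable_fun_cells.
have mpq k : measurable_fun setT (fun x => (s * q k x)%:E).
  by apply/measurable_EFinP; apply: measurable_funM => //; exact: measurable_cst.
have sq0 k x : (0 <= (s * q k x)%:E)%E by rewrite lee_fin mulr_ge0 ?q0 ?(ltW s0).
apply: (@le_trans _ _ (\int[mu]_x (s%:E + \sum_(0 <= k <oo) (s * q k x)%:E))%E).
  apply: ge0_le_integral => //.
  - apply/measurable_EFinP/measurableT_comp => //.
    by apply: measurable_funB => //; exact: measurable_repos.
  - apply: emeasurable_funD; first exact: measurable_cst.
    by apply: ge0_emeasurable_sum => // k x _ _; exact: sq0.
rewrite ge0_integralD//; last 3 first.
- by move=> x _; rewrite lee_fin ltW.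
- by move=> x _; apply: nneseries_ge0.
- by apply: ge0_emeasurable_sum => // k x _ _; exact: sq0.
rewrite integral_nneseries//.
have -> : (\int[mu]_x s%:E = s%:E)%E.
  apply: etrans (integral_cst mu measurableT s%:E) _.
  by apply: etrans (congr1 _ (probability_setT mu)) _; rewrite mule1.
apply: (@le_trans _ _ (s%:E + (s * (k1%:R * (eta * a / 4) + (L + 4) * 2))%:E)%E).
  rewrite leeD2l//; apply: nneseries_le => [k|K]; first exact: integral_ge0.
  rewrite big_mkord.
  have -> : \sum_(k < K) (\int[mu]_x (s * q k x)%:E)%E =
      \sum_(k < K) (s * \int[mu]_x q k x)%:E.
    apply: eq_bigr => k _; rewrite rintegralE; last exact: rintegrableZ.
    by rewrite RintegralZl//; exact: iq.
  by rewrite sumEFin lee_fin -mulr_sumr ler_pM2l.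
rewrite -EFinD lee_fin.
have H3 : s * (2 * L + 9) <= eta / 2.
  rewrite /s mulrAC ler_pdivrMr//; 
  have -> : eta / 2 * (4 * (L + 5)) = eta * (2 * L + 10) by field.
  by rewrite ler_pM2l// lerD2l ler_nat.
have H4 : s * (k1%:R * (eta * a / 4)) <= eta / 4.
  have -> : s * (k1%:R * (eta * a / 4)) = k1%:R * (s * a) * (eta / 4) by field.
  by rewrite ler_piMl// divr_ge0// ltW.
rewrite !mulrDr; move: H3; rewrite mulrDr; lra.
Qed.

End near_invariant.

(** * Operators *)

Section operators.
Context {R : realType} {V : normedModType R[i]}.
Implicit Types (u v : V).

Definition rnorm u : R := Re `|u|.

Lemma rnormE u : `|u| = real_complex R (rnorm u).
Proof.
have := normr_ge0 u; rewrite /rnorm; case: `|u| => a b.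
by rewrite lecE/= => /andP[/eqP-> _].
Qed.

Lemma rnorm_le u v : (`|u| <= `|v|) = (rnorm u <= rnorm v).
Proof. by rewrite !rnormE lecR. Qed.

Lemma rnorm_ge0 u : 0 <= rnorm u.
Proof. by have := normr_ge0 u; rewrite rnormE -[0]/(real_complex R 0) lecR. Qed.

Lemma rnormD u v : rnorm (u + v) <= rnorm u + rnorm v.
Proof. by have := ler_normD u v; rewrite !rnormE -rmorphD lecR. Qed.

Lemma rnormZ (c : R[i]) u : rnorm (c *: u) = normc c * rnorm u.
Proof.
have := normrZ c u; rewrite cnormE !rnormE -rmorphM => /complexI.
exact.
Qed.

Lemma rnormZr (c : R) u : 0 <= c -> rnorm (real_complex R c *: u) = c * rnorm u.
Proof.
by move=> c0; rewrite rnormZ; congr (_ * _); rewrite /= expr0n/= addr0 sqrtr_sqr ger0_norm.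
Qed.

Lemma rnormN u : rnorm (- u) = rnorm u.
Proof. by rewrite /rnorm normrN. Qed.

(* Either [A] decreases the norm of [v] by a fixed amount, or [v] is close to
   [E v]; both cases are beaten by a small multiple of [A \o E]. *)
Lemma opnorm_perturbation (A E : {linear V -> V}) (dl : R) : 0 < dl <= 1 ->
  (forall u, `|A u| <= `|u|) -> (forall u, `|E u| <= `|u|) ->
  (forall u, rnorm u = 1 -> 1 - dl <= rnorm (A u) -> rnorm (u - E u) <= 2^-1) ->
  (opnorm (iter 1 A \- (real_complex R (dl / 4) \*: (A \o E)))%R < 1)%E.
Proof.
move=> /andP[dl0 dl1] cA cE near.
pose l := dl / 4; have l0 : 0 < l by rewrite divr_gt0.
have l1 : l <= 4^-1 by rewrite /l ler_pdivrMr// mulVf.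
pose T u := A u - real_complex R l *: A (E u).
have TZ c w : T (c *: w) = c *: T w.
  rewrite /T; have -> : E (c *: w) = c *: E w by rewrite linearZ.
  have AZ (x : V) : A (c *: x) = c *: A x by rewrite linearZ.
  by rewrite !AZ scalerBr !scalerA mulrC.
have cA' u : rnorm (A u) <= rnorm u by rewrite -rnorm_le.
have cE' u : rnorm (E u) <= rnorm u by rewrite -rnorm_le.
have unit u : rnorm u = 1 -> rnorm (T u) <= 1 - l / 2.
  move=> u1; have Au := cA' u; rewrite u1 in Au.
  (* In the first case the bound is [1 - l + l / 2]; in the second it is [1 - dl + l], that is
     [1 - 3 * l]. *)
  have [big|small] := leP (1 - dl) (rnorm (A u)).
    have -> : T u = real_complex R (1 - l) *: A u + real_complex R l *: A (u - E u).
      rewrite linearB/= scalerBr rmorphB rmorph1 scalerBl scale1r /T.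
      by rewrite addrA subrK.
    apply: le_trans (rnormD _ _) _; rewrite !rnormZr ?(ltW l0)//; last by lra.
    have := le_trans (cA' (u - E u)) (near u u1 big).
    move=> /(ler_wpM2l (ltW l0)); have : (1 - l) * rnorm (A u) <= (1 - l) * 1.
      by rewrite ler_wpM2l//; lra.
    lra.
  apply: le_trans (rnormD _ _) _; rewrite rnormN rnormZr ?(ltW l0)//.
  have := le_trans (cA' (E u)) (cE' u); rewrite u1 => /(ler_wpM2l (ltW l0)).
  by rewrite /l in l0 l1 *; lra.
apply: (@le_lt_trans _ _ (1 - l / 2)%:E); last by rewrite lte_fin; lra.
apply: ge_ereal_sup => _ [u /= u1 <-]; rewrite lee_fin -/(rnorm _).
rewrite [leLHS](_ : _ = rnorm (T u)); last by [].
have u1' : rnorm u <= 1 by move: u1; rewrite rnormE -[1]/(real_complex R 1) lecR.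
have [u0|un0] := eqVneq (rnorm u) 0.
  have -> : u = 0 by apply/normr0_eq0; rewrite rnormE u0.
  rewrite /T (linear0 E) (linear0 A) scaler0 subr0 /rnorm normr0/=; lra.
have up : 0 < rnorm u by rewrite lt_def un0 rnorm_ge0.
pose v := real_complex R (rnorm u)^-1 *: u.
have v1 : rnorm v = 1 by rewrite rnormZr ?invr_ge0 ?rnorm_ge0// mulVf.
have -> : u = real_complex R (rnorm u) *: v.
  by rewrite scalerA -rmorphM mulfV// rmorph1 scale1r.
rewrite TZ.
rewrite rnormZr ?rnorm_ge0//; have := unit v v1.
have := rnorm_ge0 (T v); nra.
Qed.

Lemma scale_real_continuous (b : R[i]) v (t : R) :
  {for t, continuous (fun t : R => (b * real_complex R t) *: v)}.
Proof.
apply/cvgrPdist_lt => e e0.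
have [e1 e1E] : exists e1 : R, e = real_complex R e1.
  exists (Re e); move: e0; case: e => x y; rewrite ltcE/= => /andP[/eqP-> _].
  by [].
have e10 : 0 < e1 by move: e0; rewrite e1E -[0]/(real_complex R 0) ltcR.
have M0 : 0 < normc b * rnorm v + 1.
  by rewrite ltr_wpDl// mulr_ge0 ?normc_ge0 ?rnorm_ge0.
have : \forall t' \near t, `|t - t'| < e1 / (normc b * rnorm v + 1).
  have := (@cvgrPdist_lt R R R (nbhs t) _ id t).1 (@cvg_id _ _).
  by apply; rewrite divr_gt0.
apply: filterS => t'; rewrite ltr_pdivlMr// => tt'.
rewrite -scalerBl -mulrBr -rmorphB rnormE e1E ltcR rnormZ normcM.
have -> : normc (real_complex R (t - t')) = `|t - t'|.
  by rewrite /= expr0n/= addr0 sqrtr_sqr.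
apply: le_lt_trans tt'.
by have := normr_ge0 (t - t'); have := rnorm_ge0 v; have := normc_ge0 b; nra.
Qed.

Lemma continuous_sum_fin (X : topologicalType) n (F : 'I_n -> X -> V) :
  (forall i, continuous (F i)) -> continuous (fun x => \sum_(i < n) F i x).
Proof.
elim: n F => [|n IH] F cF.
  rewrite (_ : (fun x => _) = cst 0); first by move=> x; exact: cvg_cst.
  by apply/funext => x; rewrite big_ord0.
rewrite (_ : (fun x => _) =
    (fun x => \sum_(i < n) F (widen_ord (leqnSn n) i) x + F ord_max x)).
  by move=> x; apply: cvgD; [exact: IH|exact: cF].
by apply/funext => x; rewrite big_ord_recr.
Qed.

(** Splitting coefficients into real and imaginary parts puts the image of the unit ball inside the
    continuous image [Psi @] of a compact real box of dimension [N + N]. *)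
Lemma finite_rank_compact (K : {linear V -> V}) N (y : 'I_N -> V) (M : R) :
  (forall u, `|u| <= 1 -> exists2 a : 'I_N -> R[i], forall i, normc (a i) <= M &
     K u = \sum_(i < N) a i *: y i) ->
  compact_operator K.
Proof.
move=> HK; pose Psi (v : 'rV[R]_(N + N)) : V :=
  \sum_(i < N) ((1 * real_complex R (v ord0 (lshift N i))) *: y i +
                (Complex 0 1 * real_complex R (v ord0 (rshift N i))) *: y i).
have cPsi : continuous Psi.
  apply: continuous_sum_fin => i v.
  have c1 : {for v, continuous (fun w : 'rV[R]_(N + N) =>
      (1 * real_complex R (w ord0 (lshift N i))) *: y i)}.
    exact: (cvg_comp _ _ (@coord_continuous R 1 _ ord0 (lshift N i) v)
      (@scale_real_continuous 1 (y i) (v ord0 (lshift N i)))).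
  have c2 : {for v, continuous (fun w : 'rV[R]_(N + N) =>
      (Complex 0 1 * real_complex R (w ord0 (rshift N i))) *: y i)}.
    exact: (cvg_comp _ _ (@coord_continuous R 1 _ ord0 (rshift N i) v)
      (@scale_real_continuous (Complex 0 1) (y i) (v ord0 (rshift N i)))).
  exact: (continuousD c1 c2).
pose box := [set v : 'rV[R]_(N + N) | forall i, `[- M, M]%classic (v ord0 i)].
have cbox : compact box.
  exact: (@rV_compact R (N + N) (fun=> `[- M, M]%classic) (fun=> @segment_compact R (- M) M)).
have cim : compact (Psi @` box).
  exact: (continuous_compact (continuous_subspaceT cPsi) cbox).
have clim : closed (Psi @` box) by exact: (compact_closed (@norm_hausdorff _ _) cim).
apply: (subclosed_compact (@closed_closure _ _) cim).
rewrite [X in _ `<=` X]((closure_id _).1 clim); apply: closure_subset.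
move=> _ [u /= u1 <-]; have [a aM ->] := HK u u1.
exists (\row_j match fintype.split j with inl i => Re (a i) | inr i => Im (a i) end).
  move=> j; rewrite mxE /= in_itv/=; case: (fintype.split j) => i; rewrite -ler_norml.
    exact: le_trans (Re_normc _) (aM i).
  exact: le_trans (Im_normc _) (aM i).
apply: eq_bigr => i _; rewrite !mxE (unsplitK (inl i)) (unsplitK (inr i)).
rewrite -scalerDl; congr (_ *: _); case: (a i) => p q /=.
rewrite mul1r; apply/eqP; rewrite eq_complex/=.
by apply/andP; split; apply/eqP; ring.
Qed.

End operators.

(** * Conditional expectation on a finite partition *)

Section conditional_expectation.
Context {d : measure_display} {S : measurableType d} {R : realType}.
Variables (mu : probability S R) (c : S -> nat) (N : nat).
Hypothesis mc : measurable_cells c.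
Hypothesis cN : forall x, (c x < N)%N.
Hypothesis mpos : forall i, (i < N)%N -> 0 < mass mu (cell c i).

(** The conditional probability given cell [i]. For a null cell the normalization falls back on
    [mu], so every label gets a probability. *)
Definition cell_prob (i : nat) : pprobability S R :=
  mnormalize (mrestr mu (mc i)) mu.

Lemma measurable_cell_prob : measurable_fun setT (cell_prob \o c).
Proof. exact: measurable_fun_cells. Qed.

(* The kernel whose Markov operator is the conditional expectation given [c]. *)
Definition cell_kernel : R.-pker S ~> S := kprobability measurable_cell_prob.

Lemma cell_probE i B : (i < N)%N -> measurable B ->
  cell_prob i B = (mass mu (B `&` cell c i) / mass mu (cell c i))%:E.
Proof.
move=> iN mB; pose ev := mu (setT `&` cell c i).
have -> : cell_prob i B = (if (ev == 0) || (ev == +oo) then fun U => mu U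
    else fun U => mu (U `&` cell c i) * ((fine ev)^-1)%:E)%E B by [].
have -> : ev = (mass mu (cell c i))%:E by rewrite /ev setTI massE.
rewrite ifF; last by rewrite orbF eqe gt_eqF// mpos.
rewrite EFinM; congr (_ * _)%E; apply/esym/massE; exact: measurableI.
Qed.

Lemma cell_prob_cell i : (i < N)%N -> cell_prob i (~` cell c i) = 0%E.
Proof.
move=> iN; rewrite cell_probE//; last exact: measurableC.
by rewrite setICl /mass measure0 mul0r.
Qed.

(** The law of total probability. It makes conditional expectation an instance of [markov_op], with
    linearity and contraction inherited. *)
Lemma cell_kernel_bistochastic : bistochastic mu cell_kernel.
Proof.
move=> B mB; have mBc i : measurable (B `&` cell c i) by exact: measurableI.
have -> : (\int[mu]_x cell_kernel x B = \int[mu]_x (\sum_(i < N)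
    mass mu (B `&` cell c i) / mass mu (cell c i) * \1_(cell c i) x)%:E)%E.
  apply: eq_integral => x _; rewrite [LHS]cell_probE//; congr EFin.
  rewrite (bigD1 (Ordinal (cN x)))//= big1 ?addr0.
    by rewrite indic_cell eqxx mulr1.
  move=> i ix; rewrite indic_cell; case: eqVneq => [cx|_]; last by rewrite mulr0.
  by move: ix; rewrite -val_eqE/= cx eqxx.
have ii (i : 'I_N) : rintegrable mu (fun x =>
    mass mu (B `&` cell c i) / mass mu (cell c i) * \1_(cell c i) x).
  by apply: rintegrableZ; exact: rintegrable_indic.
rewrite rintegralE; last exact: rintegrable_sum.
rewrite Rintegral_sum// -massE//; congr EFin.
transitivity (\int[mu]_x \sum_(i < N) \1_(B `&` cell c i) x : R).
  rewrite Rintegral_sum; last by move=> i; exact: rintegrable_indic.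
  apply: eq_bigr => i _; rewrite RintegralZl//; last exact: rintegrable_indic.
  rewrite !Rintegral_indic// -/(mass mu _) -/(mass mu (cell c i)) divfK//.
  by rewrite gt_eqF// mpos.
rewrite /mass -Rintegral_indic//; apply: eq_Rintegral => x _.
rewrite (bigD1 (Ordinal (cN x)))//= big1 ?addr0.
  by rewrite setIC indicI/= indic_cell eqxx mul1r.
move=> i ix; rewrite indicI/= indic_cell; case: eqVneq => [cx|_]; last by rewrite mulr0.
by move: ix; rewrite -val_eqE/= cx eqxx.
Qed.

Definition cell_mean (f : S -> R[i]) (i : nat) : R[i] := cintegral (cell_prob i) f.

Lemma cmeasurable_cells (phi : nat -> R[i]) : cmeasurable (phi \o c).
Proof.
by split; [exact: (measurable_fun_cells (fun i => Re (phi i)))|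
           exact: (measurable_fun_cells (fun i => Im (phi i)))].
Qed.

Lemma cell_mean_cells (phi : nat -> R[i]) i : (i < N)%N ->
  cell_mean (phi \o c) i = phi i.
Proof.
move=> iN; rewrite /cell_mean.
rewrite (@cintegral_ae_eq _ _ _ _ _ (cst (phi i))).
- rewrite /cintegral !Rintegral_cst// (_ : fine _ = 1) ?mulr1; last first.
    exact: (congr1 fine (probability_setT _)).
  by case: (phi i).
- exact: cmeasurable_cells.
- exact: cmeasurable_cst.
- exists (~` cell c i); split; [exact: measurableC|exact: cell_prob_cell|].
  by move=> x /= nx cx; apply: nx => _; rewrite cx.
Qed.

Variable r : R.
Hypothesis r1 : 1 < r.
Hypothesis r1' : (1 <= r%:E)%E.

Lemma cells_Lfun (phi : nat -> R[i]) : phi \o c \in cLfun mu r%:E.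
Proof.
apply/cLfun_rintegrable; first exact: ltW.
split; first exact: cmeasurable_cells.
apply: (@le_rintegrable _ _ _ _ _ (fun=> \sum_(i < N) normc (phi i) `^ r)).
- exact/measurable_normcX/cmeasurable_cells.
- move=> x; rewrite ger0_norm ?powR_ge0// (bigD1 (Ordinal (cN x)))//= lerDl.
  by apply: sumr_ge0 => i _; exact: powR_ge0.
- exact: rintegrable_cst.
Qed.

Local Notation V := (cLspace mu r1').

Definition cells_class (phi : nat -> R[i]) : V := cLclass (CLfun r1' (cells_Lfun phi)).

Definition cond_exp : {linear V -> V} :=
  markov_op cell_kernel_bistochastic r1'.

Lemma cond_exp_class (f : cLfunType mu r1') :
  cond_exp (cLclass f) = cells_class (cell_mean f).
Proof. by rewrite /cond_exp/= markov_opE; apply/cLclassP; exact: aeW. Qed.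

Lemma cond_exp_cells (phi : nat -> R[i]) :
  cond_exp (cells_class phi) = cells_class phi.
Proof.
rewrite /cells_class cond_exp_class; apply/cLclassP; apply: aeW => x _ /=.
exact: cell_mean_cells.
Qed.

Definition cell_class (i : nat) : V := cells_class (fun j => (j == i)%:R).

Lemma cells_class_sum phi :
  cells_class phi = \sum_(i < N) phi i *: cell_class i.
Proof.
pose s (i : nat) : cLfunType mu r1' :=
  phi i *: CLfun r1' (cells_Lfun (fun j => (j == i)%:R)).
have E n : \sum_(i < n) phi i *: cell_class i = cLclass (\sum_(i < n) s i).
  elim: n => [|n IH]; first by rewrite !big_ord0.
  by rewrite !big_ord_recr/= IH cLclassD /s cLclassZ.
have F n x : (\sum_(i < n) s i : cLfunType mu r1') x =
    \sum_(i < n) phi i * (c x == i)%:R.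
  by elim: n => [|n IH]; [rewrite !big_ord0|rewrite !big_ord_recr/= -IH].
rewrite E; apply/cLclassP; apply: aeW => x _; rewrite F.
rewrite (bigD1 (Ordinal (cN x)))//= eqxx mulr1 big1 ?addr0// => i ix.
case: eqVneq => [cx|_]; last by rewrite mulr0.
by move: ix; rewrite -val_eqE/= cx eqxx.
Qed.

Lemma rnorm_class (f : cLfunType mu r1') :
  rnorm (cLclass f) = fine (cLnorm mu r%:E f).
Proof.
by have : `|cLclass f| = real_complex R (fine (cLnorm mu r%:E f));
  [exact: cLspace_normE|rewrite rnormE => /complexI].
Qed.

Lemma rnorm_cell_class_gt0 i : (i < N)%N -> 0 < rnorm (cell_class i).
Proof.
move=> iN; rewrite rnorm_class cLnorm_rintegral ?(ltW r1) ?cells_Lfun//=.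
apply: powR_gt0; rewrite (_ : \int[mu]_x _ = mass mu (cell c i)) ?mpos//.
rewrite -[RHS](Rintegral_indic mu (mc i)); apply: eq_Rintegral => x _.
rewrite indic_cell; case: eqVneq => _.
  have -> : normc (true%:R : R[i]) = 1 by rewrite /= expr1n expr0n/= addr0 sqrtr1.
  by rewrite powR1.
have -> : normc (false%:R : R[i]) = 0 by exact: normc0.
by rewrite powR0// gt_eqF// (lt_trans ltr01).
Qed.

(** The function [phi \o c] dominates in modulus its restriction to cell [i], where it is constant.
    This bounds the coordinates on the unit ball. *)
Lemma cells_class_coord phi (i : nat) : (i < N)%N ->
  normc (phi i) <= rnorm (cells_class phi) / rnorm (cell_class i).
Proof.
move=> iN; have i0 := rnorm_cell_class_gt0 iN.
rewrite ler_pdivlMr// -rnormZ.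
have -> : phi i *: cell_class i = cells_class (fun j => phi i * (j == i)%:R).
  by rewrite /cell_class /cells_class -cLclassZ; apply/cLclassP; exact: aeW.
rewrite !rnorm_class fine_le ?cLnorm_fin_num//.
apply: le_Lnorm => //; try exact/measurable_EFinP/measurable_normc/cmeasurable_cells.
apply/aeW => x; rewrite /= lee_fin !ger0_norm ?normc_ge0//.
case: eqVneq => [->|_]; first by rewrite mulr1.
by rewrite mulr0 normc0 normc_ge0.
Qed.

Lemma compact_after_cond_exp (A : {linear V -> V}) (l : R[i]) :
  compact_operator (l \*: (A \o cond_exp)).
Proof.
pose M := \sum_(i < N) (rnorm (cell_class i))^-1.
apply: (@finite_rank_compact _ _ _ N (fun i => l *: A (cell_class i)) M) => u u1.
pose phi := cell_mean (repr u).
have Eu : cond_exp u = cells_class phi.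
  by rewrite -{1}(cLclass_repr u) cond_exp_class.
exists (fun i => phi i) => [i|].
  apply: le_trans (cells_class_coord phi (ltn_ord i)) _.
  have p0 (j : 'I_N) : 0 <= (rnorm (cell_class j))^-1 by rewrite invr_ge0 rnorm_ge0.
  apply: le_trans (_ : (rnorm (cell_class i))^-1 <= _); last first.
    by rewrite /M (bigD1 i)//= lerDl sumr_ge0.
  rewrite ler_piMl// -Eu; apply: (@le_trans _ _ (rnorm u)).
    by rewrite -rnorm_le; exact: markov_op_norm.
  by move: u1; rewrite rnormE -[1]/(real_complex R 1) lecR.
rewrite /= Eu cells_class_sum linear_sum scaler_sumr; apply: eq_bigr => i _.
by rewrite linearZ/= !scalerA mulrC.
Qed.

End conditional_expectation.

(** A complex number is the sum of four positive parts along 1, -1, i and -i; each is the positive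
    real part after rotation by the inverse unit. *)
Lemma four_parts (R : realType) (z : R[i]) (a b e h : R) :
  z - Complex (a - b) (e - h) =
  1 * Complex (Num.max 0 (Re (1 * z)) - a) 0 +
  (-1 * Complex (Num.max 0 (Re (-1 * z)) - b) 0 +
  (Complex 0 1 * Complex (Num.max 0 (Re (- Complex 0 1 * z)) - e) 0 +
   - Complex 0 1 * Complex (Num.max 0 (Re (Complex 0 1 * z)) - h) 0)).
Proof.
have maxE (t : R) : Num.max 0 t - Num.max 0 (- t) = t.
  by rewrite !maxEle oppr_ge0; case: (leP 0 t) => t0; case: (leP t 0) => t1; lra.
apply/eqP; rewrite eq_complex !(cReD, cImD, cReM, cImM).
case: z => p q /=.
rewrite !(mul1r, mul0r, mulr0, subr0, mulN1r, oppr0, add0r, addr0, mulNr, opprK, sub0r).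
have := maxE p; have := maxE q => Hq Hp.
by apply/andP; split; apply/eqP; lra.
Qed.

(** * Quasi-compactness of the Markov operator *)

Section quasi_compactness.
Context {d : measure_display} {S : measurableType d} {R : realType}.
Variables (mu : probability S R) (P : R.-pker S ~> S).
Hypothesis muP : bistochastic mu P.
Variable r : R.
Hypothesis r1 : 1 < r.
Hypothesis r1' : (1 <= r%:E)%E.
Let r0 : 0 < r. Proof. exact: lt_trans ltr01 r1. Qed.

(** Lets [near_cells], which sees only the positive real part, be applied to rotations of [f]. *)
Lemma rotate_Lfun (k : R[i]) f : normc k = 1 -> f \in cLfun mu r%:E ->
  [/\ k *: f \in cLfun mu r%:E,
    \int[mu]_x (normc ((k *: f) x) `^ r) = \int[mu]_x (normc (f x) `^ r) &
    \int[mu]_x (normc (markov P (k *: f) x) `^ r) =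
    \int[mu]_x (normc (markov P f x) `^ r)].
Proof.
move=> k1 fL; have [mf intf] := (cLfun_rintegrable mu f (ltW r1)).1 fL.
have E x : normc ((k *: f) x) = normc (f x) by rewrite normcM k1 mul1r.
have kL : k *: f \in cLfun mu r%:E.
  apply/cLfun_rintegrable; first exact: ltW.
  split; first exact: cmeasurableZ.
  by rewrite (_ : (fun x => _) = (fun x => normc (f x) `^ r))//; apply/funext => x; rewrite E.
split; [exact: kL|by apply: eq_Rintegral => x _; rewrite E|].
have ik := rintegrable_markov muP (ltW r1) kL.
have ig := rintegrable_markov muP (ltW r1) fL.
suff H : (\int[mu]_x (normc (markov P (k *: f) x) `^ r)%:E =
    \int[mu]_x (normc (markov P f x) `^ r)%:E)%E by exact: (congr1 fine H).
apply: ae_eq_integral; first exact: measurableT.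
- by have /integrableP[] := ik.
- by have /integrableP[] := ig.
apply: filterS (markovZ muP k r1' fL) => x /(_ I) -> _.
by rewrite normcM k1 mul1r.
Qed.

Lemma cLnorm_root_dist (eta : R) (h g : S -> R) (k : R[i]) : 0 <= eta ->
  normc k = 1 -> measurable_fun setT h -> measurable_fun setT g ->
  (forall x, 0 <= h x) -> (forall x, 0 <= g x) ->
  (\int[mu]_x `|h x `^ r - g x|%:E <= eta%:E)%E ->
  (cLnorm mu r%:E (fun x => k * Complex (h x - g x `^ r^-1) 0)%R <= (eta `^ r^-1)%:E)%E.
Proof.
move=> eta0 k1 mh mg h0 g0 hg; rewrite cLnormE// -poweR_EFin.
have mr (u : S -> R) (t : R) : measurable_fun setT u ->
    measurable_fun setT (fun x => u x `^ t).
  by move=> mu'; exact: (measurableT_comp (measurable_powR t)).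
have E x : normc (k * Complex (h x - g x `^ r^-1) 0) = `|h x - g x `^ r^-1|.
  by rewrite normcM k1 mul1r /= expr0n/= addr0 sqrtr_sqr.
apply: gt0_ler_poweR.
- by rewrite invr_ge0 ltW.
- by rewrite in_itv/= leey andbT integral_ge0// => x _; rewrite lee_fin powR_ge0.
- by rewrite in_itv/= leey andbT lee_fin.
apply: le_trans hg; apply: ge0_le_integral => //.
- by move=> x _; rewrite lee_fin powR_ge0.
- under eq_fun do rewrite E.
  apply/measurable_EFinP; apply: (measurableT_comp (measurable_powR r)).
  apply: measurableT_comp => //; apply: measurable_funB => //; exact: mr.
- apply/measurable_EFinP; apply: measurableT_comp => //.
  by apply: measurable_funB => //; exact: mr.
- move=> x _; rewrite E lee_fin.
  apply: le_trans (powR_dist (ltW r1) (h0 x) (powR_ge0 _ _)) _.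
  by rewrite -powRrM mulVf ?gt_eqF// powRr1.
Qed.

(** [near_cells] is applied to the four rotations of [f]; its partition does not depend on the
    function, so the four approximations are constant on the same cells. *)
Lemma near_cells_complex (a eta : R) : 0 < a -> 0 < eta ->
  (forall A, measurable A -> mass mu A < a -> mass mu A <= 4 * energy mu P A) ->
  exists N c (dl : R), [/\ 0 < dl, measurable_cells c, forall x, (c x < N)%N,
    forall i, (i < N)%N -> 0 < mass mu (cell c i) &
    forall f, f \in cLfun mu r%:E -> \int[mu]_x (normc (f x) `^ r) = 1 ->
      1 - dl <= \int[mu]_x (normc (markov P f x) `^ r) ->
    exists phi : nat -> R[i],
      (cLnorm mu r%:E (f - (phi \o c))%R <= (4 * eta `^ r^-1)%:E)%E].
Proof.
move=> a0 eta0 small; have [N [c [dl [dl0 mc cN mpos near]]]] :=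
  near_cells muP r1 a0 eta0 small.
exists N, c, dl; split => // f fL f1 Pf1.
have [mf intf] := (cLfun_rintegrable mu f (ltW r1)).1 fL.
pose ps (k : R[i]) x := Num.max 0 (Re (k * f x)).
have part (k l : R[i]) : normc k = 1 -> normc l = 1 ->
    exists g : nat -> R, (cLnorm mu r%:E
      (fun x => l * Complex (ps k x - g (c x)) 0)%R <= (eta `^ r^-1)%:E)%E /\
      cmeasurable (fun x => l * Complex (ps k x - g (c x)) 0).
  move=> k1 l1; have [kL E1 E2] := rotate_Lfun k1 fL.
  have [||g g0 hg] := near _ kL; [by rewrite E1|by rewrite E2|].
  exists (fun i => g i `^ r^-1).
  have mps : measurable_fun setT (ps k).
    have [mk _] := cmeasurableZ k mf.
    by apply: measurable_maxr => //; exact: measurable_cst.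
  have mgc : measurable_fun setT (fun x => g (c x)) by exact: (measurable_fun_cells g).
  split.
    have ps0 x : 0 <= ps k x by rewrite le_max lexx.
    have hg' : (\int[mu]_x `|ps k x `^ r - g (c x)|%:E <= eta%:E)%E by exact: hg.
    exact: (@cLnorm_root_dist eta (ps k) (fun x => g (c x)) l (ltW eta0) l1 mps mgc
      ps0 (fun x => g0 (c x)) hg').
  apply: (cmeasurableZ l (f := fun x => Complex (ps k x - g (c x) `^ r^-1) 0)).
  split; last exact: measurable_cst.
  exact: (measurable_funB mps (measurable_fun_cells (fun i => g i `^ r^-1) mc)).
have n1 : normc (1 : R[i]) = 1 by rewrite /= expr1n expr0n/= addr0 sqrtr1.
have nN1 : normc (-1 : R[i]) = 1 by rewrite normcN.
have ni : normc (Complex 0 1 : R[i]) = 1 by rewrite /= expr1n expr0n/= add0r sqrtr1.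
have nNi : normc (- Complex 0 1 : R[i]) = 1 by rewrite normcN.
have [g1 [H1 M1]] := part _ _ n1 n1.
have [g2 [H2 M2]] := part _ _ nN1 nN1.
have [g3 [H3 M3]] := part _ _ nNi ni.
have [g4 [H4 M4]] := part _ _ ni nNi.
exists (fun i => Complex (g1 i - g2 i) (g3 i - g4 i)).
pose F1 x := 1 * Complex (ps 1 x - g1 (c x)) 0.
pose F2 x := -1 * Complex (ps (-1) x - g2 (c x)) 0.
pose F3 x := Complex 0 1 * Complex (ps (- Complex 0 1) x - g3 (c x)) 0.
pose F4 x := - Complex 0 1 * Complex (ps (Complex 0 1) x - g4 (c x)) 0.
have -> : f - ((fun i => Complex (g1 i - g2 i) (g3 i - g4 i)) \o c) =
    F1 + (F2 + (F3 + F4)).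
  by apply/funext => x; exact: four_parts.
have D u v : cmeasurable u -> cmeasurable v ->
    (cLnorm mu r%:E (u + v)%R <= cLnorm mu r%:E u + cLnorm mu r%:E v)%E.
  by move=> mu' mv; exact: cLnormD.
have m34 : cmeasurable (F3 + F4) by exact: cmeasurableD.
have m234 : cmeasurable (F2 + (F3 + F4)) by exact: cmeasurableD.
apply: le_trans (D _ _ M1 m234) _; apply: le_trans (leeD2l _ (D _ _ M2 m34)) _.
apply: le_trans (leeD2l _ (leeD2l _ (D _ _ M3 M4))) _.
apply: le_trans (leeD H1 (leeD H2 (leeD H3 H4))) _.
by rewrite -!EFinD lee_fin; lra.
Qed.

Lemma markov_quasi_compact : hyperbounded mu P -> quasi_compact (markov_op muP r1').
Proof.
move=> /(hyperbounded_small_sets muP)[a a0 small].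
split; first exact: markov_op_continuous.
(* With this choice four times the r-th root of [eta] is 1/4. *)
pose eta : R := 16^-1 `^ r.
have eta0 : 0 < eta by rewrite powR_gt0// invr_gt0.
have etaE : eta `^ r^-1 = 16^-1.
  by rewrite -powRrM mulfV ?gt_eqF// powRr1// invr_ge0.
have [N [c [dl [dl0 mc cN mpos near]]]] := near_cells_complex a0 eta0 small.
pose E := cond_exp mc cN mpos r1'.
pose A : {linear cLspace mu r1' -> cLspace mu r1'} := markov_op muP r1'.
(* Division by [r] converts a defect of the norm into one of its r-th power: (1 - l)^r is at least
   [1 - r * l], hence at least [1 - dl]. *)
pose l := Num.min dl 1 / r.
have l0 : 0 < l by rewrite divr_gt0// lt_min dl0 ltr01.
have ldl : r * l <= dl by rewrite mulrC divfK ?gt_eqF// ge_min lexx.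
have l1 : l <= 1.
  by rewrite ler_pdivrMr// mul1r ge_min (ltW r1) orbT.
exists 1%N, (real_complex R (l / 4) \*: (A \o E)); split => //.
  exact: compact_after_cond_exp.
apply: opnorm_perturbation; first by rewrite l0.
- by move=> u; exact: markov_op_norm.
- by move=> u; exact: markov_op_norm.
move=> u; rewrite -(cLclass_repr u); move: (repr u) => {u} f f1 Af.
have fL := cLfun_prop f.
pose I h : R := \int[mu]_x (normc (h x) `^ r).
have I0 h : 0 <= I h by apply: Rintegral_ge0 => x _; exact: powR_ge0.
have If : I f = 1.
  move: f1; rewrite rnorm_class cLnorm_rintegral ?(ltW r1)//= -/(I f).
  move=> /(congr1 (@powR R ^~ r)).
  by rewrite -powRrM mulVf ?gt_eqF// powRr1// powR1.
have IPf : 1 - dl <= I (markov P f).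
  move: Af; rewrite [A _]markov_opE rnorm_class cLnorm_rintegral ?(ltW r1)//=; last first.
    exact: markov_cLfun.
  rewrite -/(I (markov P f)) => Af.
  apply: le_trans (_ : (1 - l) `^ r <= _); last first.
    have := ge0_ler_powR (ltW r0) _ _ Af; rewrite -powRrM mulVf ?gt_eqF// powRr1//.
    by apply; rewrite nnegrE ?subr_ge0 ?powR_ge0.
  have l1' : 0 <= 1 - l by rewrite subr_ge0.
  (* Bernoulli's inequality, as the tangent inequality at 1. *)
  have := young_tangent (ltW r1) l1' ler01; rewrite !powR1 !mulr1; lra.
have [phi Hphi] := near f fL If IPf.
pose v := cLclass f; pose w := cells_class mu mc cN r1 r1' phi.
have vw : rnorm (v - w) <= 4^-1.
  have -> : v - w = cLclass (f - CLfun r1' (cells_Lfun mu mc cN r1 phi)).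
    by rewrite cLclassD; congr (_ + _); rewrite -cLclass_opp.
  rewrite rnorm_class -lee_fin fineK ?cLnorm_fin_num//.
  apply: le_trans Hphi _; rewrite lee_fin etaE; lra.
(* [E] fixes [w], so the distance from [v] to [E v] is at most twice that from [v] to [w]. *)
have -> : v - E v = (v - w) - E (v - w).
  by rewrite linearB/= [E w]cond_exp_cells opprB addrA subrK.
apply: le_trans (rnormD _ _) _; rewrite rnormN.
have : rnorm (E (v - w)) <= rnorm (v - w) by rewrite -rnorm_le; exact: markov_op_norm.
lra.
Qed.

End quasi_compactness.

Theorem corollary3p11 (d : measure_display) (S : measurableType d)
    (R : realType) (mu : probability S R) (P : R.-pker S ~> S)
    (muP : bistochastic mu P) (hypP : hyperbounded mu P)
    (r : \bar R) (r1 : (1 < r)%E) (ry : (r < +oo)%E) :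
  quasi_compact (markov_op muP (Order.POrderTheory.ltW r1)).
Proof.
move: r r1 ry => [r| |] r1 //= _.
have r1' : 1 < r by rewrite -lte_fin.
exact: markov_quasi_compact.
Qed.
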